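(* Let $\Sigma$ be an alphabet, $k\ge1$, and $\mathcal F$ a $k$-searchable family of graphs over $\Sigma$. Consider $k$-head graph-walking automata with nested pebbles extended with the jump instructions. Then, on $\mathcal F$, the graph languages accepted by deterministic such automata are exactly those definable by closed formulas of FO+DTC$^k$: for every such automaton $\mathcal A$ there is a closed FO+DTC$^k$ formula $\phi$ with $\{g\in\mathcal F\mid g\in L(\mathcal A)\}=\{g\in\mathcal F\mid g\models\phi\}$, and conversely. That is, $\mathrm{DPTWA}^k=\mathrm{FO{+}DTC}^k$ on $\mathcal F$.
   Context: Graphs: nonempty finite directed graphs, weakly connected, whose nodes and edges are labelled from a common alphabet $\Sigma$, such that no node has two outgoing edges with the same label nor two incoming edges with the same label (parallel edges and loops allowed). Logic for graphs: node variables; atomic formulas $\mathrm{lab}_\sigma(x)$, $\mathrm{edg}_\sigma(x,y)$ ($\sigma$-labelled edge from $x$ to $y$), $x=y$; closed under $\neg,\wedge,\vee,\exists,\forall$. $k$-ary transitive closure: for $\phi$ with $k$-tuples $\bar x,\bar y$ of distinct free variables (other free variables fixed), $g\models\phi^*(\bar u,\bar v)$ iff there are $k$-tuples $\bar u_0=\bar u,\dots,\bar u_n=\bar v$ ($n\ge0$) with $g\models\phi(\bar u_i,\bar u_{i+1})$ for all $i<n$; deterministic if $\phi$ is functional (for every graph, valuation of the other variables and $\bar u$, at most one $\bar v$ satisfies $\phi(\bar u,\bar v)$). FO+DTC$^k$ allows only deterministic $k$-ary transitive closure. Automata: a $k$-head graph-walking automaton with nested pebbles is $\mathcal A=(Q,\Sigma,X,q_0,A,I)$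 with finite states, finite pebble set $X$, initial state $q_0$, accepting states $A$, and instructions $\langle p,\chi,q\rangle$ where $\chi$ is $\mathrm{inmove}_{i,\sigma}$ / $\mathrm{outmove}_{i,\sigma}$ (move head $i$ backwards along its incoming / forwards along its outgoing $\sigma$-labelled edge), $\mathrm{drop}_i(x)$ (push $(x,u[i])$ on the pebble stack if $x$ is not on it), $\mathrm{retrieve}(x)$ (pop the top pair if its pebble is $x$, regardless of head positions), or a test $\mathrm{lab}_{i,\sigma}$, $\mathrm{peb}_i(x)$, $\mathrm{inedge}_{i,\sigma}$, $\mathrm{outedge}_{i,\sigma}$ on the node under head $i$, or its negation. The jump instruction $\langle p,\mathrm{jump}_i(x),q\rangle$ moves head $i$ to the node where pebble $x$ currently lies (applicable if $x$ is on the stack). Configurations are $[p,\bar u,\alpha]$; halting if no instruction applies. $\mathrm{acc}(u)$ means that from $[q_0,(u,\dots,u),\varepsilon]$ some halting $[q,\bar v,\varepsilon]$ with $q\in A$ is reachable; automata are required to satisfy, for every graph over $\Sigma$, $\mathrm{acc}(u_1)\Rightarrow\mathrm{acc}(u_2)$ for all nodes $u_1,u_2$, and $L(\mathcal A)$ is the set of graphs $g$ with $\mathrm{acc}(u)$ for all nodes $u$. $\mathcal A$ is deterministic if any two distinct instructions from the same state have $\chi_1=\neg\chi_2$ or $\chi_2=\neg\chi_1$. $k$-searchable: a family $\mathcal F$ is $k$-searchable if there is a fixed deterministic $k$-head graph-walking automaton with nested pebbles (the guide), moving at most one head per step, such that for every graph in $\mathcal F$ and every node of it, when started with all heads at that node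 in its initial state, it halts after a walk during which every node of the graph is visited (by some head) at least once. *)

(* Defs.v *)
From mathcomp Require Import all_boot.

Set Implicit Arguments.
Unset Strict Implicit.
Unset Printing Implicit Defensive.

(* [edg s x y] says that there is an s-labelled edge from x to y: edges form a
   subset of node * Sigma * node, so parallel edges carry different labels. *)
Record graph (Sigma : finType) := Graph {
  node :> finType;
  lab : node -> Sigma;
  edg : Sigma -> rel node;
  node_nonempty : 0 < #|node|;
  edg_out_unique : forall s x y z, edg s x y -> edg s x z -> y = z;
  edg_in_unique : forall s x y z, edg s x z -> edg s y z -> x = y;
  weakly_connected : forall x y,
    connect [rel a b | [exists s, edg s a b || edg s b a]] x y
}.

(* Variables are natural numbers.  [TC xs ys phi us vs] is phi^*(us, vs), the
   closure being taken with respect to xs and ys, which it binds in phi. *)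
Inductive formula (Sigma : finType) (k : nat) : Type :=
| Lab of Sigma & nat
| Edg of Sigma & nat & nat
| Eq of nat & nat
| Not of formula Sigma k
| And of formula Sigma k & formula Sigma k
| Or of formula Sigma k & formula Sigma k
| Ex of nat & formula Sigma k
| All of nat & formula Sigma k
| TC of k.-tuple nat & k.-tuple nat & formula Sigma k
     & k.-tuple nat & k.-tuple nat.

Section Logic.
Variables (Sigma : finType) (k : nat).
Implicit Type phi : formula Sigma k.

Fixpoint fv phi : seq nat :=
  match phi with
  | Lab _ x => [:: x]
  | Edg _ x y | Eq x y => [:: x; y]
  | Not p => fv p
  | And p q | Or p q => fv p ++ fv q
  | Ex x p | All x p => [seq z <- fv p | z != x]
  | TC xs ys p us vs => [seq z <- fv p | z \notin xs ++ ys] ++ us ++ vs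
  end.

Definition closed_formula phi : Prop := fv phi = [::].

(* When size us = size xs, a variable z outside xs has index size us, so that
   [nth] falls back on e z. *)
Definition bind (V : Type) (e : nat -> V) (xs : seq nat) (us : seq V) :
  nat -> V := fun z => nth (e z) us (index z xs).

Fixpoint holds (g : graph Sigma) (e : nat -> g) phi : bool :=
  match phi with
  | Lab s x => lab (e x) == s
  | Edg s x y => edg s (e x) (e y)
  | Eq x y => e x == e y
  | Not p => ~~ holds e p
  | And p q => holds e p && holds e q
  | Or p q => holds e p || holds e q
  | Ex x p => [exists v : g, holds (bind e [:: x] [:: v]) p]
  | All x p => [forall v : g, holds (bind e [:: x] [:: v]) p]
  | TC xs ys p us vs =>
      connect [rel a b : k.-tuple g | holds (bind e (xs ++ ys) (a ++ b)) p]
        (map_tuple e us) (map_tuple e vs)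
  end.

Definition functional (xs ys : k.-tuple nat) phi : Prop :=
  forall (g : graph Sigma) (e : nat -> g) (a b b' : k.-tuple g),
    holds (bind e (xs ++ ys) (a ++ b)) phi ->
    holds (bind e (xs ++ ys) (a ++ b')) phi -> b = b'.

Fixpoint FO_DTC phi : Prop :=
  match phi with
  | Lab _ _ | Edg _ _ _ | Eq _ _ => True
  | Not p | Ex _ p | All _ p => FO_DTC p
  | And p q | Or p q => FO_DTC p /\ FO_DTC q
  | TC xs ys p _ _ => [/\ uniq (xs ++ ys), functional xs ys p & FO_DTC p]
  end.

Definition models (g : graph Sigma) phi : Prop :=
  forall e : nat -> g, holds e phi.

End Logic.

Inductive test (Sigma X : finType) (k : nat) : Type :=
| LabAt of 'I_k & Sigma
| PebAt of 'I_k & X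
| InEdge of 'I_k & Sigma
| OutEdge of 'I_k & Sigma.

Inductive action (Sigma X : finType) (k : nat) : Type :=
| InMove of 'I_k & Sigma
| OutMove of 'I_k & Sigma
| Drop of 'I_k & X
| Retrieve of X
| Jump of 'I_k & X
| Test of test Sigma X k
| NegTest of test Sigma X k.

(* [action Sigma pebble k] has finitely many inhabitants, so [instr] is the
   characteristic function of a finite set of instructions. *)
Record automaton (Sigma : finType) (k : nat) := Automaton {
  state : finType;
  pebble : finType;
  init : state;
  accepting : {set state};
  instr : state -> action Sigma pebble k -> state -> bool
}.

Section Automata.
Variables (Sigma : finType) (k : nat).
Implicit Types (A : automaton Sigma k) (g : graph Sigma).

(* The top of the pebble stack is the head of the list. *)
Record config A g := Config {
  cstate : state A;
  heads : k.-tuple g;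
  stack : seq (pebble A * g)
}.

Definition move_head g (u : k.-tuple g) (i : 'I_k) (v : g) : k.-tuple g :=
  [tuple if j == i then v else tnth u j | j < k].

Definition eval_test (X : finType) g (t : test Sigma X k)
    (u : k.-tuple g) (st : seq (X * g)) : bool :=
  match t with
  | LabAt i s => lab (tnth u i) == s
  | PebAt i x => (x, tnth u i) \in st
  | InEdge i s => [exists v, edg s v (tnth u i)]
  | OutEdge i s => [exists v, edg s (tnth u i) v]
  end.

Definition exec (X : finType) g (a : action Sigma X k)
    (u : k.-tuple g) (st : seq (X * g))
    (u' : k.-tuple g) (st' : seq (X * g)) : Prop :=
  match a with
  | InMove i s =>
      exists v, [/\ edg s v (tnth u i), u' = move_head u i v & st' = st]
  | OutMove i s =>
      exists v, [/\ edg s (tnth u i) v, u' = move_head u i v & st' = st]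
  | Drop i x =>
      [/\ x \notin [seq p.1 | p <- st], u' = u & st' = (x, tnth u i) :: st]
  | Retrieve x => u' = u /\ exists v, st = (x, v) :: st'
  | Jump i x => exists v, [/\ (x, v) \in st, u' = move_head u i v & st' = st]
  | Test t => [/\ eval_test t u st, u' = u & st' = st]
  | NegTest t => [/\ ~~ eval_test t u st, u' = u & st' = st]
  end.

Definition step A g (c c' : config A g) : Prop :=
  exists2 a, instr (cstate c) a (cstate c')
           & exec a (heads c) (stack c) (heads c') (stack c').

Definition halting A g (c : config A g) : Prop := forall c', ~ step c c'.

Definition walk A g (n : nat) (w : nat -> config A g) : Prop :=
  forall i, i < n -> step (w i) (w i.+1).

Definition reachable A g (c c' : config A g) : Prop :=
  exists n w, [/\ w 0 = c, w n = c' & walk n w].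

Definition start A g (u : g) : config A g :=
  Config (init A) [tuple u | _ < k] [::].

Definition acc A g (u : g) : Prop :=
  exists q v, [/\ q \in accepting A,
                  reachable (start A u) (Config q v [::]) &
                  halting (Config q v [::] : config A g)].

Definition start_independent A : Prop :=
  forall g (u1 u2 : g), acc A u1 -> acc A u2.

Definition language A g : Prop := forall u : g, acc A u.

Definition opposite (X : finType) (a b : action Sigma X k) : Prop :=
  exists t, (a = NegTest t /\ b = Test t) \/ (b = NegTest t /\ a = Test t).

Definition deterministic A : Prop :=
  forall p a1 q1 a2 q2, instr p a1 q1 -> instr p a2 q2 ->
    (a1, q1) <> (a2, q2) -> opposite (X := pebble A) a1 a2.

Definition jump_free A : Prop :=
  forall p i x q, ~~ instr p (Jump Sigma (X := pebble A) i x) q.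

Definition guides A g : Prop :=
  forall u : g, exists n (w : nat -> config A g),
    [/\ w 0 = start A u, walk n w, halting (w n)
      & forall v : g, exists2 m, m <= n & v \in heads (w m)].

End Automata.

Definition searchable (Sigma : finType) (k : nat)
    (F : graph Sigma -> Prop) : Prop :=
  exists A : automaton Sigma k,
    [/\ deterministic A, jump_free A & forall g, F g -> guides A g].

(* Main.v *)
Require Import Defs.
From HB Require Import structures.
From mathcomp Require Import all_boot zify.

(* From automata to formulas: by nesting, the computations of an automaton that
   leave the pebble stack unchanged split into macro steps, each being one
   instruction or a computation of the same kind between dropping and retrieving a
   pebble.  With the positions of the pebbles as parameters, macro steps are defined
   by induction on the number of free pebbles, and their iteration by eliminating
   the states of the automaton one by one, as for regular expressions.

   From formulas to automata: the guide enumerates the nodes, and a node found by it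
   is kept by dropping a pebble, so Boolean connectives and quantifiers are evaluated
   by structural induction.  For a deterministic closure from [u] to [v], iterating
   from [u] might loop; instead the tree of the tuples leading to [v] is traversed
   depth-first from [v], children being ordered by their first occurrence in the
   enumeration of all tuples by the guide.  The traversal only needs the current
   tuple, which is moved from one place to another by the [k] heads. *)

Set Implicit Arguments.
Unset Strict Implicit.
Unset Printing Implicit Defensive.

(** * Transitive closure, valuations and automata *)

(** Two obstacles shape the proof. Macro steps can be iterated by deterministic closures only
    because they are functional: in a deterministic automaton a state with a drop or a retrieve has
    no other instruction, so the computation between the two has a unique end. In the other
    direction the automaton must not depend on its starting node on any graph over the alphabet,
    while the guide is known to work on [F] only: elsewhere it may loop or miss nodes. Programs that
    run before the guide is known to succeed are therefore specified for partial correctness on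
    every graph and for termination where the guide does its job, and acceptance is made to imply
    that the guide succeeds from every node. Since pebbles are nested, a subprogram has to restore
    the stack; it may leave the heads anywhere, because jumps bring them back to saved positions.
    Every tuple component or quantified variable in scope takes a level of its own, with a private
    copy of the guide's pebbles, so the number of levels is bounded in terms of the formula and
    [k]. *)

Section Star.
Variable T : Type.
Variable r : T -> T -> Prop.

Inductive star (x : T) : T -> Prop :=
| star_refl : star x x
| star_right y z : star x y -> r y z -> star x z.

Lemma star_trans y x z : star x y -> star y z -> star x z.
Proof. by move=> xy; elim=> // u v _ xu uv; exact: star_right uv. Qed.

Lemma star1 x y : r x y -> star x y.
Proof. exact/star_right/star_refl. Qed.

Lemma star_left y x z : r x y -> star y z -> star x z.
Proof. by move=> /star1; exact: star_trans. Qed.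

Lemma star_ind_left z (P : T -> Prop) :
  P z -> (forall x y, r x y -> star y z -> P y -> P x) ->
  forall x, star x z -> P x.
Proof.
move=> Pz Pl x xz; elim: xz Pz Pl => // {}z y _ IH yz Pz Pl.
apply: IH; first exact: Pl yz (star_refl _) Pz.
by move=> u v uv vy; apply: Pl => //; exact: star_right vy yz.
Qed.

Lemma star_cases x z : star x z -> x = z \/ exists2 y, r x y & star y z.
Proof.
by move: x; apply: star_ind_left; [left | move=> x y xy yz _; right; exists y].
Qed.

(** For a functional relation the paths from [x] are prefixes of one another, so only one of them
    ends where no step is possible. Applied below to the computation between a drop and its
    retrieve. *)
Lemma star_terminal_inj x y z :
  (forall a b c, r a b -> r a c -> b = c) ->
  (forall b, ~ r y b) -> (forall b, ~ r z b) -> star x y -> star x z -> y = z.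
Proof.
move=> r_fun y_end z_end; move: x; apply: star_ind_left.
  by move=> /star_cases[//|[u /y_end]].
move=> x u xu uy IH /star_cases[xz|[w xw wz]]; first by case: (z_end u); rewrite -xz.
by apply: IH; rewrite (r_fun _ _ _ xu xw).
Qed.

End Star.

Lemma connect_star (T : finType) (e : rel T) x y :
  connect e x y <-> star (fun a b => e a b) x y.
Proof.
split=> [/connectP[p]|].
  elim: p x => [|z p IH] x /= => [_ ->|/andP[xz pz] yE]; first exact: star_refl.
  by apply: star_left (xz : e x z) _; exact: IH.
by elim=> // u z _ xu uz; apply: connect_trans xu (connect1 uz).
Qed.

Lemma star_ext (T : Type) (r r' : T -> T -> Prop) x y :
  (forall a b, r a b -> r' a b) -> star r x y -> star r' x y.
Proof.
move=> rr'; elim=> [|u z _ xu uz]; first exact: star_refl.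
by apply: star_right xu _; exact: rr'.
Qed.

(** * Actions form a finite type, so the instructions of an automaton can be enumerated *)

Section ActionFin.
Variables (Sigma X : finType) (k : nat).

Definition test_code (t : test Sigma X k) :=
  match t with
  | LabAt i s => inl (inl (i, s))
  | PebAt i x => inl (inr (i, x))
  | InEdge i s => inr (inl (i, s))
  | OutEdge i s => inr (inr (i, s))
  end.

Definition test_decode c : test Sigma X k :=
  match c with
  | inl (inl (i, s)) => LabAt _ i s
  | inl (inr (i, x)) => PebAt _ i x
  | inr (inl (i, s)) => InEdge _ i s
  | inr (inr (i, s)) => OutEdge _ i s
  end.

Lemma test_codeK : cancel test_code test_decode. Proof. by case. Qed.

HB.instance Definition _ := Finite.copy (test Sigma X k) (can_type test_codeK).

Definition action_code (a : action Sigma X k) :=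
  match a with
  | InMove i s => inl (inl (i, s))
  | OutMove i s => inl (inr (i, s))
  | Drop i x => inr (inl (inl (i, x)))
  | Jump i x => inr (inl (inr (i, x)))
  | Retrieve x => inr (inr (inl x))
  | Test t => inr (inr (inr (inl t)))
  | NegTest t => inr (inr (inr (inr t)))
  end.

Definition action_decode c : action Sigma X k :=
  match c with
  | inl (inl (i, s)) => InMove _ i s
  | inl (inr (i, s)) => OutMove _ i s
  | inr (inl (inl (i, x))) => Drop _ i x
  | inr (inl (inr (i, x))) => Jump _ i x
  | inr (inr (inl x)) => Retrieve _ _ x
  | inr (inr (inr (inl t))) => Test t
  | inr (inr (inr (inr t))) => NegTest t
  end.

Lemma action_codeK : cancel action_code action_decode. Proof. by case. Qed.

HB.instance Definition _ :=
  Finite.copy (action Sigma X k) (can_type action_codeK).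

End ActionFin.

(** * Binding a block of variables *)

Section Bind.
Variable V : Type.
Implicit Types (e : nat -> V) (xs : seq nat) (us : seq V).

Lemma bind_notin e xs us z :
  size us = size xs -> z \notin xs -> bind e xs us z = e z.
Proof. by rewrite /bind => Es /memNindex ->; rewrite nth_default // Es. Qed.

Lemma map_bind e xs us :
  uniq xs -> size us = size xs -> map (bind e xs us) xs = us.
Proof.
move=> Ux Es; case: us Es => [|u us] Es; first by case: xs Es {Ux}.
apply: (@eq_from_nth _ u); first by rewrite size_map.
move=> i; rewrite size_map => lti.
have x0 : nat by [].
rewrite (nth_map 0) // /bind index_uniq //.
by apply: set_nth_default; rewrite Es.
Qed.

Lemma map_bind_notin e xs us zs : size us = size xs ->
  (forall z, z \in zs -> z \notin xs) -> map (bind e xs us) zs = map e zs.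
Proof. by move=> Es zsP; apply/eq_in_map => z /zsP; exact: bind_notin. Qed.

(** Distinctness is essential: with a repeated variable the innermost of the nested bindings would
    win on the left, the first entry of the list on the right. *)
Lemma bind_cons e x xs v us z : size us = size xs -> uniq (x :: xs) ->
  bind (bind e [:: x] [:: v]) xs us z = bind e (x :: xs) (v :: us) z.
Proof.
move=> Es /= /andP[x_xs _]; rewrite {1}/bind; have [z_xs|z_xs] := boolP (z \in xs).
  have nxz: x != z by apply: contraNneq x_xs => ->.
  rewrite /bind /= (negPf nxz) /=; apply: set_nth_default.
  by rewrite Es index_mem.
by rewrite memNindex // nth_default ?Es // /bind /= memNindex //=; case: eqP;
  rewrite //= nth_default ?Es.
Qed.

End Bind.

(** * Coincidence, blocks of quantifiers and universal closure *)

Section LogicLemmas.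
Variables (Sigma : finType) (k : nat).
Implicit Types (phi : formula Sigma k) (g : graph Sigma).

Lemma holds_fv phi g (e e' : nat -> g) :
  {in fv phi, e =1 e'} -> holds e phi = holds e' phi.
Proof.
have bindP (d d' : nat -> g) xs us s : size us = size xs ->
    {in [seq z <- s | z \notin xs], d =1 d'} ->
    {in s, bind d xs us =1 bind d' xs us}.
  move=> Es dd' z zs; rewrite /bind; have [zx|zx] := boolP (z \in xs).
    by apply: set_nth_default; rewrite Es index_mem.
  by rewrite memNindex // !nth_default ?Es // dd' // mem_filter zx.
elim: phi e e' => [s x|s x y|x y|p IH|p IHp q IHq|p IHp q IHq|x p IH|x p IH|xs ys p IH us vs]
  e e' /= ee'.
- by rewrite ee' ?inE.
- by rewrite !ee' ?inE ?eqxx ?orbT.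
- by rewrite !ee' ?inE ?eqxx ?orbT.
- by rewrite (IH e e').
- by rewrite (IHp e e') ?(IHq e e') // => z zp; apply: ee'; rewrite mem_cat zp ?orbT.
- by rewrite (IHp e e') ?(IHq e e') // => z zp; apply: ee'; rewrite mem_cat zp ?orbT.
- apply: eq_existsb => v; apply: IH; apply: bindP => // z.
  by rewrite mem_filter inE => zp; apply: ee'; rewrite mem_filter.
- apply: eq_forallb => v; apply: IH; apply: bindP => // z.
  by rewrite mem_filter inE => zp; apply: ee'; rewrite mem_filter.
have Eus (ws : k.-tuple nat) : {subset ws <= us ++ vs} ->
    map_tuple e ws = map_tuple e' ws.
  move=> sub; apply: val_inj; apply/eq_in_map => z /sub zws.
  by apply: ee'; rewrite mem_cat zws orbT.
rewrite !Eus; try by move=> z zu; rewrite mem_cat zu ?orbT.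
apply: eq_connect => a b /=; apply: IH; apply: bindP.
  by rewrite !size_cat !size_tuple.
by move=> z zp; apply: ee'; rewrite mem_cat zp.
Qed.

Lemma holds_ext phi g (e e' : nat -> g) : e =1 e' -> holds e phi = holds e' phi.
Proof. by move=> ee'; apply: holds_fv => z _. Qed.

Definition exs (xs : seq nat) phi := foldr (@Ex Sigma k) phi xs.

Lemma holds_exs xs phi g (e : nat -> g) : uniq xs ->
  holds e (exs xs phi) <->
  exists2 us, size us = size xs & holds (bind e xs us) phi.
Proof.
elim: xs e => [|x xs IH] e /=.
  move=> _; have E : holds (bind e [::] [::]) phi = holds e phi.
    by apply: holds_ext => z; rewrite /bind.
  by split=> [e_phi|[[|//] _]]; rewrite ?E //; exists [::]; rewrite ?E.
move=> Ux; have /andP[_ Uxs] := Ux; split=> [/existsP[v]|[[//|v us]]].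
  case/(IH _ Uxs) => us Es us_phi; exists (v :: us); first by rewrite /= Es.
  by rewrite -(@holds_ext _ _ _ _ (fun z => @bind_cons _ e x xs v us z Es Ux)).
move=> [Es] us_phi; apply/existsP; exists v; apply/IH => //; exists us => //.
by rewrite (@holds_ext _ _ _ _ (fun z => @bind_cons _ e x xs v us z Es Ux)).
Qed.

Lemma FO_DTC_exs xs phi : FO_DTC (exs xs phi) <-> FO_DTC phi.
Proof. by elim: xs => //= x xs ->. Qed.

(* [Eq 0 0] stands for truth. *)
Definition conj_seq (l : seq (formula Sigma k)) := foldr (@And _ _) (Eq _ _ 0 0) l.
Lemma holds_conj l g (e : nat -> g) : holds e (conj_seq l) = all (holds e) l.
Proof. by elim: l => /= [|p l ->]; rewrite ?eqxx. Qed.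

Lemma FO_DTC_conj (I : Type) (f : I -> formula Sigma k) (l : seq I) :
  (forall i, FO_DTC (f i)) -> FO_DTC (conj_seq (map f l)).
Proof. by move=> fP; elim: l => //= i l IH; split. Qed.

Definition eqs (xs ys : seq nat) : formula Sigma k :=
  conj_seq [seq Eq _ _ z.1 z.2 | z <- zip xs ys].

Lemma FO_DTC_eqs xs ys : FO_DTC (eqs xs ys).
Proof. exact: FO_DTC_conj. Qed.

Lemma holds_eqs xs ys g (e : nat -> g) : size xs = size ys ->
  holds e (eqs xs ys) <-> map e xs = map e ys.
Proof.
rewrite /eqs holds_conj; elim: xs ys => [|x xs IH] [|y ys] //= [Es].
split=> [/andP[/eqP-> /(IH _ Es) ->] //|[-> /(IH _ Es) ->]]; by rewrite eqxx.
Qed.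

Definition alls (xs : seq nat) phi := foldr (@All Sigma k) phi xs.

Lemma fv_alls xs phi z : z \in fv (alls xs phi) = (z \in fv phi) && (z \notin xs).
Proof.
elim: xs => [|x xs IH] /=; first by rewrite andbT.
by rewrite mem_filter IH inE negb_or andbCA.
Qed.

Lemma closed_alls phi : closed_formula (alls (fv phi) phi).
Proof.
rewrite /closed_formula; case E: (fv _) => [//|z s].
have: z \in fv (alls (fv phi) phi) by rewrite E inE eqxx.
by rewrite fv_alls; case: (z \in fv phi).
Qed.

(** [models] already ranges over all valuations. Hence the formula of an automaton may be built with
    free variables and closed at the end. *)
Lemma models_alls xs phi g : models g (alls xs phi) <-> models g phi.
Proof.
elim: xs => //= x xs IH; rewrite -IH; split=> M e; last by apply/forallP=> v; exact: M.
have /forallP/(_ (e x)) : [forall v, holds (bind e [:: x] [:: v]) (alls xs phi)] := M e.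
rewrite (@holds_ext _ _ (bind e [:: x] [:: e x]) e) // => z.
by rewrite /bind /=; case: eqP => [->|].
Qed.

Lemma FO_DTC_alls xs phi : FO_DTC (alls xs phi) <-> FO_DTC phi.
Proof. by elim: xs => //= x xs ->. Qed.

End LogicLemmas.

(** * Consequences of determinism *)

Section AutomataLemmas.
Variables (Sigma : finType) (k : nat).
Implicit Types (A : automaton Sigma k) (g : graph Sigma).

Lemma tnth_move_head g (u : k.-tuple g) i v j :
  tnth (move_head u i v) j = if j == i then v else tnth u j.
Proof. by rewrite tnth_mktuple. Qed.

Lemma reachable_star A g (c c' : config A g) :
  reachable c c' <-> star (@step _ _ A g) c c'.
Proof.
split=> [[n [w [<- <- ww]]]|].
  elim: n ww => [|n IH] ww; first exact: star_refl.
  by apply: star_right (ww n (leqnn _)); apply: IH => i lti; apply: ww; exact: ltnW.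
elim=> [|d e _ [n [w [w0 wn ww]]] de]; first by exists 0, (fun _ => c).
exists n.+1, (fun i => if i <= n then w i else e); split=> //; first by rewrite ltnn.
move=> i; rewrite ltnS => lei; rewrite lei; move: lei.
rewrite leq_eqVlt => /predU1P[->|lti]; last by rewrite lti; exact: ww.
by rewrite ltnn wn.
Qed.

Definition flat (X : finType) (a : action Sigma X k) :=
  match a with Drop _ _ | Retrieve _ => false | _ => true end.

Lemma exec_flat (X : finType) g (a : action Sigma X k) (u : k.-tuple g) st u' st' :
  flat a -> exec a u st u' st' -> st' = st.
Proof. by case: a => //= [i s|i s|i x|t|t] _; try case=> v; case. Qed.

(** A label determines an edge at either end, and a jump is unambiguous as soon as the stack holds
    each pebble at one node only. *)
Lemma exec_fun (X : finType) g (a : action Sigma X k) (u : k.-tuple g) st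
    u1 st1 u2 st2 :
  (forall x v w, (x, v) \in st -> (x, w) \in st -> v = w) ->
  exec a u st u1 st1 -> exec a u st u2 st2 -> u1 = u2 /\ st1 = st2.
Proof.
move=> st_fun; case: a => [i s|i s|i x|x|i x|t|t] /=.
- by move=> [v [sv -> ->]] [w [sw -> ->]]; rewrite (edg_in_unique sv sw).
- by move=> [v [sv -> ->]] [w [sw -> ->]]; rewrite (edg_out_unique sv sw).
- by move=> [_ -> ->] [_ -> ->].
- by move=> [-> [v ->]] [-> [w [_ ->]]].
- by move=> [v [sv -> ->]] [w [sw -> ->]]; rewrite (st_fun x v w).
- by move=> [_ -> ->] [_ -> ->].
- by move=> [_ -> ->] [_ -> ->].
Qed.

Lemma det_instr A p a1 q1 a2 q2 : deterministic A ->
  instr (a := A) p a1 q1 -> instr p a2 q2 ->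
  (a1 = a2 /\ q1 = q2) \/ opposite a1 a2.
Proof.
move=> dA i1 i2; have [[-> ->]|/eqP ne] := @eqP _ (a1, q1) (a2, q2); first by left.
by right; apply: dA i1 i2 _ => /eqP; apply/negP.
Qed.

Definition is_test (X : finType) (a : action Sigma X k) :=
  match a with Test _ | NegTest _ => true | _ => false end.

(** Only opposite tests may share a state, so an instruction that is not a test is alone in its
    state. *)
Lemma det_instr_eq A p a1 q1 a2 q2 : deterministic A ->
  instr (a := A) p a1 q1 -> instr p a2 q2 -> ~~ (is_test a1 && is_test a2) ->
  a1 = a2 /\ q1 = q2.
Proof.
by move=> dA i1 i2; case: (det_instr dA i1 i2) => // -[t [[-> ->]|[-> ->]]].
Qed.

Lemma opposite_exec (X : finType) g (a1 a2 : action Sigma X k) (u : k.-tuple g) st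
    u1 st1 u2 st2 :
  opposite a1 a2 -> exec a1 u st u1 st1 -> exec a2 u st u2 st2 -> False.
Proof.
by move=> [t [[-> ->]|[-> ->]]] /= [t1 _ _] [t2 _ _]; move: t1 t2; case: (eval_test _ _ _).
Qed.

End AutomataLemmas.

(** * Definable relations between tuples *)

Section Definability.
Variables (Sigma : finType) (k : nat) (X : finType).
Implicit Types (phi : formula Sigma k) (g : graph Sigma).

(* Variables [0, k) hold the source tuple, [k, 2k) the target tuple, [2k, 3k)
   an intermediate tuple, and the pebbles follow. *)
Definition xv : k.-tuple nat := [tuple (i : nat) | i < k].
Definition yv : k.-tuple nat := [tuple k + i | i < k].
Definition zv : k.-tuple nat := [tuple k + (k + i) | i < k].
Definition pv (x : X) : nat := k + (k + (k + enum_rank x)).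

Definition pebs (g : graph Sigma) (e : nat -> g) : {ffun X -> g} :=
  [ffun x => e (pv x)].

(** Every pebble has a position here, even a free one, whose value is then meaningless; which
    pebbles are on the stack is recorded separately, by the sequence given to [stk]. *)
Definition tuple_rel := forall g : graph Sigma,
  {ffun X -> g} -> k.-tuple g -> k.-tuple g -> Prop.

Definition definable (R : tuple_rel) := exists2 phi : formula Sigma k, FO_DTC phi &
  forall g (e : nat -> g),
    holds e phi <-> R g (pebs e) (map_tuple e xv) (map_tuple e yv).

Lemma mem_xv z : (z \in xv) = (z < k).
Proof.
apply/mapP/idP => [[i _ ->] //|ltz].
by exists (Ordinal ltz) => //; rewrite mem_enum.
Qed.

Lemma mem_yv z : (z \in yv) = (k <= z < k + k).
Proof.
apply/mapP/idP => [[i _ ->]|/andP[lez ltz]]; first by rewrite leq_addr ltn_add2l /=.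
have ltz' : z - k < k by lia.
by exists (Ordinal ltz'); rewrite ?mem_enum //= subnKC.
Qed.

Lemma mem_zv z : (z \in zv) = (k + k <= z < k + (k + k)).
Proof.
apply/mapP/idP => [[i _ ->]|/andP[lez ltz]].
  by have := ltn_ord i; lia.
have ltz' : z - (k + k) < k by lia.
by exists (Ordinal ltz'); rewrite ?mem_enum //=; lia.
Qed.

Lemma uniq_xv : uniq xv.
Proof. by rewrite map_inj_uniq ?enum_uniq //; exact: val_inj. Qed.
Lemma uniq_yv : uniq yv.
Proof. by rewrite map_inj_uniq ?enum_uniq // => i j /addnI/val_inj. Qed.
Lemma uniq_zv : uniq zv.
Proof. by rewrite map_inj_uniq ?enum_uniq // => i j /addnI/addnI/val_inj. Qed.

Lemma uniq_xyv : uniq (xv ++ yv).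
Proof.
rewrite cat_uniq uniq_xv uniq_yv andbT; apply/hasPn => z.
by rewrite mem_yv => /andP[lez _]; rewrite /= mem_xv; lia.
Qed.

Section BindOne.
Variables (g : graph Sigma) (e : nat -> g) (xs : k.-tuple nat) (a : k.-tuple g).

Lemma bind_tuple_id : uniq xs -> map_tuple (bind e xs a) xs = a.
Proof. by move=> U; apply: val_inj; rewrite /= map_bind // !size_tuple. Qed.

Lemma bind_tuple_notin (ys : k.-tuple nat) :
  (forall z, z \in ys -> z \notin xs) -> map_tuple (bind e xs a) ys = map_tuple e ys.
Proof.
by move=> ysP; apply: val_inj; rewrite /= map_bind_notin // !size_tuple.
Qed.

Lemma bind_pebs : (forall z, z \in xs -> z < k + (k + k)) ->
  pebs (bind e xs a) = pebs e.
Proof.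
move=> xsP; apply/ffunP=> x; rewrite !ffunE bind_notin ?size_tuple //.
by apply/negP => /xsP; rewrite /pv; lia.
Qed.

End BindOne.

Lemma bind_xy g (e : nat -> g) (a b : k.-tuple g) :
  let e' := bind e (xv ++ yv) (a ++ b) in
  [/\ pebs e' = pebs e, map_tuple e' xv = a & map_tuple e' yv = b].
Proof.
move=> e'; have Es : size (a ++ b) = size (xv ++ yv) by rewrite !size_cat !size_tuple.
have := map_bind e uniq_xyv Es; rewrite map_cat => /eqP.
rewrite eqseq_cat; last by rewrite size_map (size_tuple xv) size_tuple.
move=> /andP[/eqP ea /eqP eb].
split; [|exact: val_inj|exact: val_inj].
apply/ffunP=> x; rewrite !ffunE /e' bind_notin // mem_cat mem_xv mem_yv /pv; lia.
Qed.

Lemma definable_ext (R R' : tuple_rel) :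
  (forall g p u v, R g p u v <-> R' g p u v) -> definable R -> definable R'.
Proof.
move=> RR' [phi phiP H]; exists phi => // g e; rewrite H; exact: RR'.
Qed.

Lemma definable_false : definable (fun g _ _ _ => False).
Proof. by exists (Not (Eq _ _ 0 0)) => // g e; rewrite /= eqxx. Qed.

Lemma definable_or R S : definable R -> definable S ->
  definable (fun g p u v => R g p u v \/ S g p u v).
Proof.
move=> [phi phiP HR] [psi psiP HS]; exists (Or phi psi) => // g e /=.
by rewrite -HR -HS; split=> [/orP|/orP].
Qed.

Lemma definable_and R S : definable R -> definable S ->
  definable (fun g p u v => R g p u v /\ S g p u v).
Proof.
move=> [phi phiP HR] [psi psiP HS]; exists (And phi psi) => // g e /=.
by rewrite -HR -HS; split=> [/andP|/andP].
Qed.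

Lemma definable_not R : definable R -> definable (fun g p u v => ~ R g p u v).
Proof.
move=> [phi phiP HR]; exists (Not phi) => // g e /=; rewrite -HR.
by split=> /negP.
Qed.

(** [b] speaks of the automaton and not of the graph, so it is decided while the formula is being
    built. *)
Lemma definable_guard (b : Prop) (R : tuple_rel) :
  (b \/ ~ b) -> (b -> definable R) -> definable (fun g p u v => b /\ R g p u v).
Proof.
move=> [hb|hb] dR.
  by apply: definable_ext (dR hb) => g p u v; split=> [|[]].
by apply: definable_ext definable_false => g p u v; split=> [|[]].
Qed.

Lemma definable_exists (I : finType) (R : I -> tuple_rel) :
  (forall i, definable (R i)) -> definable (fun g p u v => exists i, R i g p u v).
Proof.
move=> dR.
suff [phi phiP H] : definable (fun g p u v => exists2 i, i \in enum I & R i g p u v).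
  exists phi => // g e; rewrite H; split=> [[i _ Ri]|[i Ri]]; exists i => //.
  by rewrite mem_enum.
elim: (enum I) => [|i l IH].
  by apply: definable_ext definable_false => g p u v; split=> [|[]].
apply: definable_ext (definable_or (dR i) IH) => g p u v; split.
  by move=> [Ri|[j jl Rj]]; [exists i; rewrite ?mem_head | exists j; rewrite ?inE ?jl ?orbT].
by move=> [j]; rewrite inE => /predU1P[->|jl] Rj; [left | right; exists j].
Qed.

(** Substitution in formulas is avoided: the target variables for [R] and the source variables for
    [S] are quantified again and equated with [zv]. Nested compositions may all use the same [zv],
    as the truth of a defining formula depends only on [xv], [yv] and the pebbles. *)
Lemma definable_comp R S : definable R -> definable S ->
  definable (fun g p u v => exists2 w, R g p u w & S g p w v).
Proof.
move=> [phi phiP HR] [psi psiP HS].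
exists (exs zv (And (exs yv (And (eqs _ _ yv zv) phi))
                    (exs xv (And (eqs _ _ xv zv) psi)))).
  by apply/FO_DTC_exs; split; apply/FO_DTC_exs; split=> //; exact: FO_DTC_eqs.
move=> g e.
have mapT (f : nat -> g) (s t : k.-tuple nat) :
  map f s = map f t <-> map_tuple f s = map_tuple f t.
  by split=> [?|[]//]; exact: val_inj.
have tupleE (s : seq g) (xs : k.-tuple nat) : size s = size xs ->
  exists t : k.-tuple g, s = t.
  by rewrite size_tuple => /eqP Es; exists (Tuple Es).
have disxz z : z \in xv -> z \notin zv by rewrite mem_xv mem_zv; lia.
have disxy z : z \in xv -> z \notin yv by rewrite mem_xv mem_yv; lia.
have disyx z : z \in yv -> z \notin xv by rewrite mem_xv mem_yv; lia.
have diszx z : z \in zv -> z \notin xv by rewrite mem_xv mem_zv; lia.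
have disyz z : z \in yv -> z \notin zv by rewrite mem_yv mem_zv; lia.
have diszy z : z \in zv -> z \notin yv by rewrite mem_yv mem_zv; lia.
have lx z : z \in xv -> z < k + (k + k) by rewrite mem_xv; lia.
have ly z : z \in yv -> z < k + (k + k) by rewrite mem_yv; lia.
have lz z : z \in zv -> z < k + (k + k) by rewrite mem_zv; lia.
have holdsA (f : nat -> g) p q : holds f (And p q) = holds f p && holds f q by [].
have Esz (s t : k.-tuple nat) : size s = size t by rewrite !size_tuple.
rewrite holds_exs ?uniq_zv //; split.
  move=> [s Es]; have [w ->{s Es}] := tupleE s zv Es; set e1 := bind e zv w.
  rewrite holdsA => /andP[]; rewrite !holds_exs ?uniq_yv ?uniq_xv //.
  move=> [s Es]; have [y ->{s Es}] := tupleE s yv Es.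
  rewrite holdsA => /andP[/(@holds_eqs _ _ _ _ _ _ (Esz yv zv))/mapT].
  rewrite HR bind_tuple_id ?uniq_yv // !(bind_tuple_notin e1) // bind_pebs //.
  rewrite /e1 bind_tuple_id ?uniq_zv // !(bind_tuple_notin e) // bind_pebs // => -> Rw.
  move=> [s Es]; have [x ->{s Es}] := tupleE s xv Es.
  rewrite holdsA => /andP[/(@holds_eqs _ _ _ _ _ _ (Esz xv zv))/mapT].
  rewrite HS bind_tuple_id ?uniq_xv // !(bind_tuple_notin (bind e zv w)) // bind_pebs //.
  rewrite bind_tuple_id ?uniq_zv // !(bind_tuple_notin e) // bind_pebs // => -> Sw.
  by exists w.
move=> [w Rw Sw]; exists w; first by rewrite !size_tuple.
have Ew (t : k.-tuple nat) : size w = size t by rewrite !size_tuple.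
rewrite holdsA; apply/andP; split; apply/holds_exs; rewrite ?uniq_xv ?uniq_yv //;
  exists w; rewrite // holdsA; apply/andP; split; try (apply/(@holds_eqs _ _ _ _ _ _ (Esz _ _))/mapT).
- by rewrite bind_tuple_id ?uniq_yv // bind_tuple_notin // bind_tuple_id ?uniq_zv.
- apply/HR; rewrite bind_tuple_id ?uniq_yv // !(bind_tuple_notin (bind e zv w)) //.
  by rewrite !(bind_tuple_notin e) // !bind_pebs.
- by rewrite bind_tuple_id ?uniq_xv // bind_tuple_notin // bind_tuple_id ?uniq_zv.
- apply/HS; rewrite bind_tuple_id ?uniq_xv // !(bind_tuple_notin (bind e zv w)) //.
  by rewrite !(bind_tuple_notin e) // !bind_pebs.
Qed.

Lemma definable_star R : definable R ->
  (forall g p u v v', R g p u v -> R g p u v' -> v = v') ->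
  definable (fun g p u v => star (R g p) u v).
Proof.
move=> [phi phiP HR] R_fun; exists (TC xv yv phi xv yv).
  split=> //; first exact: uniq_xyv.
  move=> g e a b b' /HR; have [-> -> ->] := bind_xy e a b => Rab /HR.
  by have [-> -> ->] := bind_xy e a b' => Rab'; exact: R_fun Rab Rab'.
move=> g e /=; rewrite connect_star.
have E (a b : k.-tuple g) : holds (bind e (xv ++ yv) (a ++ b)) phi <-> R g (pebs e) a b.
  by rewrite HR; have [-> -> ->] := bind_xy e a b.
by split; apply: star_ext => a b /= /E.
Qed.

Lemma definable_eq : definable (fun g _ u v => v = u).
Proof.
exists (eqs _ _ yv xv); first exact: FO_DTC_eqs.
move=> g e; rewrite holds_eqs ?size_tuple //; split=> [E|[]//]; exact: val_inj.
Qed.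

(** Changing a parameter amounts to quantifying its variable again and equating it with the variable
    of head [i], which in the source tuple is [i] itself. *)
Lemma definable_drop (R : tuple_rel) (x : X) (i : 'I_k) : definable R ->
  definable (fun g p u v => R g [ffun y => if y == x then tnth u i else p y] u v).
Proof.
move=> [phi phiP HR]; exists (Ex (pv x) (And (Eq _ _ (pv x) i) phi)) => //= g e.
have E w : holds (bind e [:: pv x] [:: w]) phi <->
    R g [ffun y => if y == x then w else pebs e y] (map_tuple e xv) (map_tuple e yv).
  have -> : [ffun y => if y == x then w else pebs e y] = pebs (bind e [:: pv x] [:: w]).
    apply/ffunP=> y; rewrite !ffunE /bind /=; case: eqVneq => [->|ne]; first by rewrite eqxx.
    case: eqVneq => // /addnI/addnI/addnI/val_inj/enum_rank_inj xy.
    by rewrite xy eqxx in ne.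
  have Et (t : k.-tuple nat) : (forall z, z \in t -> z < pv x) ->
      map_tuple (bind e [:: pv x] [:: w]) t = map_tuple e t.
    move=> tP; apply: val_inj; rewrite /= map_bind_notin // => z /tP.
    by rewrite inE; lia.
  by rewrite HR !Et // => z; rewrite ?mem_xv ?mem_yv /pv; lia.
have Ei w : bind e [:: pv x] [:: w] i = e i.
  by rewrite bind_notin // inE; apply/negP=> /eqP; have := ltn_ord i; rewrite /pv; lia.
have -> : tnth (map_tuple e xv) i = e i by rewrite tnth_map tnth_mktuple.
have Ex w : bind e [:: pv x] [:: w] (pv x) = w by rewrite /bind /= eqxx.
rewrite -E; split=> [/existsP[w]|H]; last apply/existsP; last exists (e i).
  by rewrite Ei Ex => /andP[/eqP->].
by rewrite Ei Ex eqxx.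
Qed.

Lemma tnth_xv g (e : nat -> g) i : tnth (map_tuple e xv) i = e i.
Proof. by rewrite tnth_map tnth_mktuple. Qed.

Lemma tnth_yv g (e : nat -> g) i : tnth (map_tuple e yv) i = e (k + i).
Proof. by rewrite tnth_map tnth_mktuple. Qed.

(** Constrains the heads other than [i]; the new position of head [i] is described separately, by
    the action. *)
Definition move_formula (i : 'I_k) : formula Sigma k :=
  conj_seq [seq Eq _ _ (k + j) j | j <- [seq (nat_of_ord j) | j <- enum 'I_k & j != i]].

Lemma holds_move g (e : nat -> g) (i : 'I_k) w :
  map_tuple e yv = move_head (map_tuple e xv) i w <->
  holds e (move_formula i) /\ e (k + i) = w.
Proof.
rewrite holds_conj all_map all_map; split=> [E|[/allP H <-]].
  have Ej (j : 'I_k) : e (k + j) = if j == i then w else e j.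
    have := congr1 (fun t => tnth t j) E.
    by rewrite tnth_move_head tnth_yv tnth_xv.
  split; last by rewrite Ej eqxx.
  by apply/allP => j; rewrite mem_filter /= => /andP[/negPf ji _]; rewrite Ej ji.
apply: eq_from_tnth => j; rewrite tnth_move_head tnth_yv tnth_xv.
case: eqVneq => [->//|ji]; apply/eqP.
by have := H j; rewrite mem_filter ji mem_enum /=; exact.
Qed.

(** [o] is the offset of the tuple under test, 0 for the source and [k] for the target. Variable
    [k + k] lies outside both blocks and can be bound. A pebble outside [s] is not on the stack, so
    its parameter must be ignored. *)
Definition test_formula (s : seq X) (o : nat) (t : test Sigma X k) : formula Sigma k :=
  match t with
  | LabAt i a => Lab _ a (o + i)
  | PebAt i x => if x \in s then Eq _ _ (pv x) (o + i) else Not (Eq _ _ 0 0)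
  | InEdge i a => Ex (k + k) (Edg _ a (k + k) (o + i))
  | OutEdge i a => Ex (k + k) (Edg _ a (o + i) (k + k))
  end.

Definition stk (g : graph Sigma) (s : seq X) (p : {ffun X -> g}) :=
  [seq (x, p x) | x <- s].

Lemma mem_stk g s (p : {ffun X -> g}) x v :
  (x, v) \in stk s p <-> x \in s /\ v = p x.
Proof.
split=> [/mapP[y ys [-> ->]] //|[xs ->]]; exact: map_f.
Qed.

Lemma holds_test s g (e : nat -> g) (o : nat) (u : k.-tuple g) t :
  (forall i : 'I_k, tnth u i = e (o + i)) -> o = 0 \/ o = k ->
  holds e (test_formula s o t) = eval_test t u (stk s (pebs e)).
Proof.
move=> uE oP; have Ew w (i : 'I_k) : bind e [:: k + k] [:: w] (o + i) = e (o + i).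
  by rewrite bind_notin // inE; apply/negP=> /eqP; have := ltn_ord i; lia.
have Ez w : bind e [:: k + k] [:: w] (k + k) = w by rewrite /bind /= eqxx.
case: t => [i a|i x|i a|i a] /=; rewrite uE //.
- case: ifP => xs /=.
    apply/eqP/idP => [E|/mem_stk[_ ->]]; last by rewrite ffunE.
    by apply/mem_stk; rewrite ffunE.
  by rewrite eqxx; apply/esym/negP => /mem_stk[]; rewrite xs.
- by apply: eq_existsb => w; rewrite Ew Ez.
- by apply: eq_existsb => w; rewrite Ew Ez.
Qed.

Lemma FO_DTC_test s o t : FO_DTC (test_formula s o t).
Proof. by case: t => //= i x; case: ifP. Qed.

Lemma definable_flat (s : seq X) (a : action Sigma X k) : flat a ->
  definable (fun g p u v => exec a u (stk s p) v (stk s p)).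
Proof.
have FOm i : FO_DTC (move_formula i) by exact: FO_DTC_conj.
have testP (t : test Sigma X k) (b : bool) :
    definable (fun g p u v => eval_test t u (stk s p) = b /\ v = u).
  apply: definable_and definable_eq; exists
    (if b then test_formula s 0 t else Not (test_formula s 0 t)).
    by case: b => /=; exact: FO_DTC_test.
  move=> g e; have E := @holds_test s g e 0 _ t (fun i => tnth_xv e i) (or_introl erefl).
  by case: b; rewrite /= E //; split=> [/negPf|->].
case: a => //= [i a|i a|i x|t|t] _.
- exists (And (Edg _ a (k + i) i) (move_formula i)) => // g e /=; rewrite tnth_xv.
  split=> [/andP[ae mv]|[w [aw /holds_move[-> Ew] _]]]; last by rewrite Ew aw.
  by exists (e (k + i)); split=> //; exact/holds_move.
- exists (And (Edg _ a i (k + i)) (move_formula i)) => // g e /=; rewrite tnth_xv.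
  split=> [/andP[ae mv]|[w [aw /holds_move[-> Ew] _]]]; last by rewrite Ew aw.
  by exists (e (k + i)); split=> //; exact/holds_move.
- have [xs|xs] := boolP (x \in s); last first.
    apply: definable_ext definable_false => g p u v; split=> // -[w [/mem_stk[]]].
    by rewrite (negPf xs).
  exists (And (Eq _ _ (k + i) (pv x)) (move_formula i)) => // g e /=.
  split=> [/andP[/eqP ae mv]|[w [/mem_stk[_ ->] /holds_move[-> ->] _]]]; last by rewrite ffunE eqxx.
  exists (e (pv x)); split=> //; last exact/holds_move.
  by apply/mem_stk; rewrite ffunE.
- by apply: definable_ext (testP t true) => g p u v; split=> [[]|[]].
- by apply: definable_ext (testP t false) => g p u v; split=> [[/negbT]|[/negPf]].
Qed.

(** * Closure of a relation with finitely many control states *)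

Section Kleene.
Variable S : finType.
Variable M : S -> S -> tuple_rel.
Hypothesis M_def : forall p q, definable (M p q).

Definition joint g (e : {ffun X -> g}) (a b : S * k.-tuple g) := M a.1 b.1 e a.2 b.2.

Hypothesis M_fun : forall g e a b c, @joint g e a b -> joint e a c -> b = c.

(* [through L]: nonempty paths whose intermediate states lie in [L].  As in the
   translation of finite automata into regular expressions, the states are added to
   [L] one at a time; the paths from [j] to its first return are functional, so
   only deterministic closures are needed, and none of higher arity than [k]. *)
Inductive through (L : seq S) g (e : {ffun X -> g}) (a : S * k.-tuple g) :
  S * k.-tuple g -> Prop :=
| through_one b : joint e a b -> through L e a b
| through_more b c : joint e a b -> b.1 \in L -> through L e b c -> through L e a c.

(** The path is forced step by step, and it has to stop at the first state outside [L]. *)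
Lemma through_fun L g e a b c : b.1 \notin L -> c.1 \notin L ->
  @through L g e a b -> through L e a c -> b = c.
Proof.
move=> bL cL ab; elim: ab c bL cL => {a b} [a b ab|a b d ab b_in bd IH] c dL cL ac.
  case: ac cL => [d ad _|d f ad dL' _ _]; first exact: M_fun ab ad.
  by rewrite (M_fun ab ad) dL' in dL.
case: ac cL => [f af|f h af fL fh] cL; first by rewrite -(M_fun ab af) b_in in cL.
by apply: IH => //; rewrite (M_fun ab af).
Qed.

Lemma through_sub L L' g e a b : {subset L <= L'} ->
  @through L g e a b -> through L' e a b.
Proof.
by move=> LL'; elim=> [|{}a c {}b ac /LL' cL _]; [left | exact: through_more].
Qed.

Lemma through_trans L g e a b c : b.1 \in L ->
  @through L g e a b -> through L e b c -> through L e a c.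
Proof.
move=> bL ab; elim: ab bL => {a b} [a b ab|a d b ad dL _ IH] bL bc.
  exact: through_more ab bL bc.
exact: through_more ad dL (IH bL bc).
Qed.

(** Kleene's decomposition: a path is cut at each of its visits to [j]. *)
Lemma through_cons j L g e a b : @through (j :: L) g e a b <->
  through L e a b \/
  exists u v, [/\ through L e a (j, u),
    star (fun u v => through L e (j, u) (j, v)) u v & through L e (j, v) b].
Proof.
have jL : j \in j :: L by rewrite mem_head.
have sub : {subset L <= j :: L} by move=> x; rewrite inE orbC => ->.
split.
  elim=> {a b} [a b ab|a b c ab bL _ IH]; first by left; left.
  move: bL; rewrite inE; have [bj _|_ /= bL] := eqVneq b.1 j.
    have Eb : b = (j, b.2) by rewrite -bj; case: (b).
    case: IH => [bc|[u [v [bu uv vc]]]].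
      by right; exists b.2, b.2; split; rewrite -?Eb //; [left | exact: star_refl].
    right; exists b.2, v; split=> //; first by rewrite -Eb; left.
    by apply: star_left uv; rewrite -Eb.
  case: IH => [bc|[u [v [bu uv vc]]]]; first by left; exact: through_more ab bL bc.
  by right; exists u, v; split=> //; exact: through_more ab bL bu.
move=> [|[u [v [au uv vb]]]]; first exact: through_sub.
apply: through_trans (through_sub sub au) _ => //.
move: vb => /(through_sub sub); elim: uv b {au} => // {}v w _ IH vw b wb.
by apply: IH; apply: through_trans (through_sub sub vw) wb.
Qed.

Lemma definable_through L p q : uniq L ->
  definable (fun g e u v => through L e (p, u) (q, v)).
Proof.
elim: L p q => [|j L IH] p q.
  move=> _; apply: definable_ext (M_def p q) => g e u v; split=> [|H]; first by left.
  by inversion H.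
move=> /= /andP[jL UL]; apply: definable_ext; last first.
  apply: definable_or (IH p q UL) _.
  apply: definable_comp (IH p j UL) _.
  apply: definable_comp (definable_star (IH j j UL) _) (IH j q UL).
  by move=> g e u v v' uv uv'; have [] := @through_fun L g e _ (j, v) (j, v') jL jL uv uv'.
move=> g e u v; rewrite through_cons; split.
  by move=> [|[w uw [w' ww' wv]]]; [left | right; exists w, w'].
by move=> [|[w [w' [uw ww' wv]]]]; [left | right; exists w => //; exists w'].
Qed.

Lemma definable_joint_star p q :
  definable (fun g e u v => star (joint e) (p, u) (q, v)).
Proof.
have starE g e a b : star (@joint g e) a b <-> b = a \/ through (enum S) e a b.
  split=> [|[->|]]; last 1 first.
  - elim=> [{}a c|{}a c d ac _ _]; [exact: star1 | exact: star_left].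
  - by move: a; apply: star_ind_left => [|a c ac _ [->|cb]]; [left | right; left
    | right; apply: through_more ac _ cb; rewrite mem_enum].
  - exact: star_refl.
apply: definable_ext; last apply: definable_or
  (definable_guard (b := q = p) _ (fun _ => definable_eq))
  (definable_through p q (enum_uniq S)).
  by move=> g e u v; rewrite starE; split=> [[[-> ->]|]|[[-> ->]|]]; [left|right|left|right].
by case: (q =P p); [left | right].
Qed.

End Kleene.
End Definability.

(** * From automata to formulas *)

Section AutomatonToFormula.
Variables (Sigma : finType) (k : nat) (A : automaton Sigma k).
Hypothesis dA : deterministic A.
Implicit Types (g : graph Sigma).
Local Notation S := (state A).
Local Notation X := (pebble A).
Local Notation instrA := (@instr Sigma k A).

Definition upd g (e : {ffun X -> g}) x (v : g) : {ffun X -> g} :=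
  [ffun y => if y == x then v else e y].

Lemma stk_upd g (s : seq X) (e : {ffun X -> g}) x v :
  x \notin s -> stk s (upd e x v) = stk s e.
Proof.
move=> xs; apply/eq_in_map => y ys; rewrite ffunE ifN //.
by apply: contraNneq xs => <-.
Qed.

Lemma stk_push g (s : seq X) (e : {ffun X -> g}) x v :
  x \notin s -> stk (x :: s) (upd e x v) = (x, v) :: stk s e.
Proof. by move=> xs; rewrite /= stk_upd // ffunE eqxx. Qed.

Lemma names_stk g (s : seq X) (e : {ffun X -> g}) : [seq z.1 | z <- stk s e] = s.
Proof. by rewrite -map_comp map_id. Qed.

(* A macro step above the stack [stk s e] leaves that stack unchanged: either a
   single instruction, or a pebble dropped, a computation in macro steps at the
   next level, and the pebble retrieved. *)
Fixpoint macro (n : nat) (s : seq X) (p q : S) : tuple_rel Sigma k X :=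
  fun g e u v =>
  (exists a, [/\ instrA p a q, flat a & exec a u (stk s e) v (stk s e)]) \/
  match n with
  | 0 => False
  | n.+1 => exists i x p' q',
      [/\ instrA p (Drop _ i x) p', instrA q' (Retrieve _ _ x) q, x \notin s
        & star (joint (macro n (x :: s)) (upd e x (tnth u i))) (p', u) (q', v)]
  end.

(** A retrieve is neither flat nor a drop, and by determinism no other instruction leaves [p]. *)
Lemma retrieve_macro_terminal n s g (e : {ffun X -> g}) p x q u b :
  instrA p (Retrieve _ _ x) q -> ~ joint (macro n s) e (p, u) b.
Proof.
move=> pR; suff flatN a r : instrA p a r -> flat a -> False.
  case: n => [|n] [[a [pa fa _]]|] //; try exact: flatN pa fa.
  by move=> [i [y [p' [q' [pa _ _ _]]]]]; have [] := det_instr_eq dA pR pa isT.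
by move=> pa fa; have [Ea _] := det_instr_eq dA pR pa isT; rewrite -Ea in fa.
Qed.

(** In the nested case both computations follow the same drop and end where no macro step is
    possible, by [retrieve_macro_terminal]; by induction the steps between are functional, so the
    ends coincide, and so do the retrieves. *)
Lemma macro_fun n s g (e : {ffun X -> g}) a b c :
  joint (macro n s) e a b -> joint (macro n s) e a c -> b = c.
Proof.
have stk_fun s' (e' : {ffun X -> g}) x v w :
  (x, v) \in stk s' e' -> (x, w) \in stk s' e' -> v = w.
  by move=> /mem_stk[_ ->] /mem_stk[_ ->].
elim: n s e a b c => [|n IH] s e [p u] [q v] [q' v'].
  move=> [[a [pa fa av]]|//] [[a' [pa' fa' av']]|//]; rewrite /= in pa pa' av av'.
  have [[Ea ->]|opp] := det_instr dA pa pa'; last by case: (opposite_exec opp av av').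
  by rewrite -Ea in av'; have [-> _] := exec_fun (@stk_fun s e) av av'.
move=> [[a [pa fa av]]|[i [x [r [t [pr tq xs rt]]]]]];
  move=> [[a' [pa' fa' av']]|[i' [x' [r' [t' [pr' tq' xs' rt']]]]]].
- rewrite /= in pa pa' av av'.
  have [[Ea ->]|opp] := det_instr dA pa pa'; last by case: (opposite_exec opp av av').
  by rewrite -Ea in av'; have [-> _] := exec_fun (@stk_fun s e) av av'.
- have [|Ea _] := det_instr_eq dA pa pr'; first by rewrite andbF.
  by rewrite Ea in fa.
- by have [Ea _] := det_instr_eq dA pr pa' isT; rewrite -Ea in fa'.
rewrite /= in pr pr' tq tq' rt rt'.
have [Ea Er] := det_instr_eq dA pr pr' isT.
case: Ea => Ei Ex; subst i' x' r'.
have [Et Ev] : (t, v) = (t', v').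
  apply: (star_terminal_inj _ _ _ rt rt') => [a b c|b tb|b tb].
  - exact: IH.
  - exact: retrieve_macro_terminal tq tb.
  - exact: retrieve_macro_terminal tq' tb.
rewrite -Et in tq'; rewrite Ev.
by have [_ ->] := det_instr_eq dA tq tq' isT.
Qed.

Lemma definable_macro n s p q : definable (macro n s p q).
Proof.
have flatP p' q' s' : definable (fun g (e : {ffun X -> g}) u v =>
    exists a, [/\ instrA p' a q', flat a & exec a u (stk s' e) v (stk s' e)]).
  pose ok a := instrA p' a q' && flat a.
  apply: (@definable_ext _ _ _
    (fun g e u v => exists a, ok a /\ exec a u (stk s' e) v (stk s' e))).
    move=> g e u v; split=> [[a [/andP[pa fa] av]]|[a [pa fa av]]]; exists a => //.
    by split=> //; apply/andP.
  apply: definable_exists => a.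
  apply: definable_guard => [|/andP[_ fa]]; first by case: (ok a); [left | right].
  exact: definable_flat.
elim: n s p q => [|n IH] s p q.
  by apply: definable_ext (flatP p q s) => g e u v; split=> [H|[]//]; left.
apply: definable_or (flatP p q s) _.
pose ok i x p' q' :=
  [&& instrA p (Drop _ i x) p', instrA q' (Retrieve _ _ x) q & x \notin s].
apply: (@definable_ext _ _ _ (fun g e u v => exists i x p' q', ok i x p' q' /\
  star (joint (macro n (x :: s)) (upd e x (tnth u i))) (p', u) (q', v))).
  move=> g e u v; split=> [[i [x [p' [q' [/and3P[? ? ?] ?]]]]]|[i [x [p' [q' [? ? ? ?]]]]]].
    by exists i, x, p', q'.
  by exists i, x, p', q'; split=> //; apply/and3P.
apply: definable_exists => i; apply: definable_exists => x.
apply: definable_exists => p'; apply: definable_exists => q'.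
apply: definable_guard => [|_]; first by case: (ok _ _ _ _); [left | right].
apply: (@definable_drop _ _ _
  (fun g e u v => star (joint (macro n (x :: s)) e) (p', u) (q', v)) x i).
apply: definable_joint_star => //.
by move=> g e a b c; exact: macro_fun.
Qed.

Lemma macro_sound n s g (e : {ffun X -> g}) p q u v : macro n s p q e u v ->
  star (@step _ _ A g) (Config p u (stk s e)) (Config q v (stk s e)).
Proof.
elim: n s e p q u v => [|n IH] s e p q u v.
  by move=> [[a [pa _ av]]|//]; apply: star1; exists a.
move=> [[a [pa _ av]]|[i [x [p' [q' [pa qa xs pq]]]]]]; first by apply: star1; exists a.
apply: (@star_left _ _ (Config p' u (stk (x :: s) (upd e x (tnth u i))))).
  by exists (Drop _ i x) => //=; rewrite names_stk stk_upd // ffunE eqxx.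
apply: (@star_right _ _ _ (Config q' v (stk (x :: s) (upd e x (tnth u i))))); last first.
  exists (Retrieve _ _ x) => //=; split=> //.
  by exists (tnth u i); rewrite stk_upd // ffunE eqxx.
suff H b : star (joint (macro n (x :: s)) (upd e x (tnth u i))) (p', u) b ->
    star (@step _ _ A g) (Config p' u (stk (x :: s) (upd e x (tnth u i))))
      (Config b.1 b.2 (stk (x :: s) (upd e x (tnth u i)))) by exact: H pq.
elim=> [|[r w] [r' w'] _ IH2 rr']; first exact: star_refl.
by apply: star_trans IH2 _; exact: IH.
Qed.

(** * Every computation splits into macro steps *)

Section Complete.
Variables (g : graph Sigma) (e0 : {ffun X -> g}) (c0 : S * k.-tuple g).

(* Decomposition of a computation at a configuration whose stack is [stk s e]: for
   each pebble on the stack, the macro steps made since it was dropped. *)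
Inductive inv : seq X -> {ffun X -> g} -> S * k.-tuple g -> Prop :=
| inv_nil b : star (joint (macro #|X| [::]) e0) c0 b -> inv [::] e0 b
| inv_cons s e p u i x p' b : inv s e (p, u) -> instrA p (Drop _ i x) p' ->
    x \notin s -> uniq s ->
    star (joint (macro (#|X| - (size s).+1) (x :: s)) (upd e x (tnth u i))) (p', u) b ->
    inv (x :: s) (upd e x (tnth u i)) b.

Lemma inv_step s e a b : inv s e a ->
  joint (macro (#|X| - size s) s) e a b -> inv s e b.
Proof.
case=> [{}a ca|{}s {}e p u i x p' {}a pi px xs us pa] ab.
  by apply: inv_nil; apply: star_right ca _; rewrite subn0 in ab.
by apply: (inv_cons pi px xs us); exact: star_right pa ab.
Qed.

Definition config_inv (c : config A g) :=
  exists s e, [/\ stack c = stk s e, uniq s & inv s e (cstate c, heads c)].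

(** A drop opens a new level, and a retrieve turns the whole top level into one macro step of the
    level below. *)
Lemma config_inv_step c c' : config_inv c -> step c c' -> config_inv c'.
Proof.
case: c c' => [p u st] [q v st'] [s [e [/= -> Us I]]] [a /= pa av].
have [fa|] := boolP (flat a).
  exists s, e; split=> //=; first exact: exec_flat fa av.
  apply: inv_step I _; have Est := exec_flat fa av; rewrite Est in av.
  by case: (_ - _) => [|n]; left; exists a.
case: a pa av => // [i x|x] pa /=.
  rewrite names_stk => -[xs -> ->] _; exists (x :: s), (upd e x (tnth u i)).
  rewrite stk_push // ; split=> //=; first by rewrite xs.
  by apply: inv_cons I pa xs Us _; exact: star_refl.
move=> [-> [w Est]] _; move Eb: (p, u) I => b I; case: I Us Est Eb => //=.
move=> {}s {}e p' u' i y p'' {}b I px ys Us pb _ [Ey _ Est] Eb.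
rewrite -{}Eb in pb.
exists s, e; split=> //=; first by rewrite -Est stk_upd.
(* The pebbles on the stack are distinct, so the index [#|X| - size s] is a successor, as a macro
   step with a drop requires. *)
have lts : size s < #|X|.
  have /card_uniqP Es : uniq (y :: s) by rewrite /= ys.
  by have := max_card (mem (y :: s)); rewrite Es.
apply: inv_step I _; rewrite -subnSK //; right.
by exists i, y, p'', p; split=> //; rewrite /= Ey.
Qed.

End Complete.

(** The parameters [e] are arbitrary because the stack is empty at both ends. *)
Lemma reachable_macro g (e : {ffun X -> g}) p u q v :
  reachable (Config p u [::] : config A g) (Config q v [::]) <->
  star (joint (macro #|X| [::]) e) (p, u) (q, v).
Proof.
rewrite reachable_star; split=> [pq|].
  suff: config_inv e (p, u) (Config q v [::]).
    by move=> [[|x s] [e' [//= _ _ I]]]; inversion I.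
  elim: pq => [|c c' _ IH cc']; last exact: config_inv_step IH cc'.
  by exists [::], e; split=> //=; apply: inv_nil; exact: star_refl.
suff H b : star (joint (macro #|X| [::]) e) (p, u) b ->
    star (@step _ _ A g) (Config p u [::]) (Config b.1 b.2 [::]) by exact: H.
elim=> [|[r w] [r' w'] _ IH rr']; first exact: star_refl.
by apply: star_trans IH _; exact: macro_sound rr'.
Qed.

(** Applicability of [a] at the target tuple when the stack is empty: a drop is then always
    possible, a retrieve or a jump never. *)
Definition app_formula (a : action Sigma X k) : formula Sigma k :=
  match a with
  | InMove i s => test_formula [::] k (InEdge X i s)
  | OutMove i s => test_formula [::] k (OutEdge X i s)
  | Drop _ _ => Eq _ _ 0 0
  | Retrieve _ | Jump _ _ => Not (Eq _ _ 0 0)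
  | Test t => test_formula [::] k t
  | NegTest t => Not (test_formula [::] k t)
  end.

(** Stated as a partial identity so that it can be composed after the closure. *)
Lemma definable_halting q :
  definable (fun g (_ : {ffun X -> g}) u v =>
    v = u /\ halting (Config q v [::] : config A g)).
Proof.
apply: definable_and (definable_eq _ _ _) _.
apply: (@definable_ext _ _ _ (fun g _ _ v => ~ exists c : action Sigma X k * S,
   instrA q c.1 c.2 /\ exists v' st', exec c.1 v [::] v' st')).
  move=> g e _ v; split=> [H [r v' st'] [a /= qa av]|H [[a r] [/= qa [v' [st' av]]]]].
    by apply: H; exists (a, r); split=> //; exists v', st'.
  by apply: (H (Config r v' st')); exists a.
apply: definable_not; apply: definable_exists => -[a r]; apply: definable_guard.
  by case: (instrA _ _ _); [left | right].
move=> _; exists (app_formula a).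
  by case: a => //= t; exact: FO_DTC_test.
move=> g e /=; have T t := @holds_test _ _ _ [::] g e k _ t
  (fun i => tnth_yv e i) (or_intror erefl).
case: a => [i s|i s|i x|x|i x|t|t]; rewrite /app_formula.
- rewrite T; split=> [/existsP[w sw]|[v' [st' [w [sw _ _]]]]]; last by apply/existsP; exists w.
  by exists (move_head (map_tuple e (yv k)) i w), [::], w.
- rewrite T; split=> [/existsP[w sw]|[v' [st' [w [sw _ _]]]]]; last by apply/existsP; exists w.
  by exists (move_head (map_tuple e (yv k)) i w), [::], w.
- rewrite /= eqxx; split=> // _.
  by exists (map_tuple e (yv k)), [:: (x, tnth (map_tuple e (yv k)) i)].
- by rewrite /= eqxx; split=> // -[v' [st' [_ [w]]]].
- by rewrite /= eqxx; split=> // -[v' [st' [w []]]].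
- by rewrite T; split=> [H|[v' [st' []]] //]; exists (map_tuple e (yv k)), [::].
- by rewrite [holds _ _]/= T; split=> [H|[v' [st' []]] //]; exists (map_tuple e (yv k)), [::].
Qed.

Definition accept_rel : tuple_rel Sigma k X := fun g e u v => exists2 q, q \in accepting A
  & star (joint (macro #|X| [::]) e) (init A, u) (q, v) /\
    halting (Config q v [::] : config A g).

Lemma definable_accept : definable accept_rel.
Proof.
apply: (@definable_ext _ _ _ (fun g e u v => exists q, q \in accepting A /\
   exists2 w, star (joint (macro #|X| [::]) e) (init A, u) (q, w)
     & v = w /\ halting (Config q v [::] : config A g))).
  move=> g e u v; split=> [[q [qA [w uw [-> qw]]]]|[q qA [uv qv]]]; exists q => //.
  by split=> //; exists v.
apply: definable_exists => q; apply: definable_guard => [|_].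
  by case: (q \in _); [left | right].
apply: definable_comp (definable_halting q); apply: definable_joint_star.
  by move=> p' q'; exact: definable_macro.
by move=> g e a b c; exact: macro_fun.
Qed.

Lemma automaton_formula : 0 < k -> exists phi : formula Sigma k,
  [/\ FO_DTC phi, closed_formula phi & forall g, language A g <-> models g phi].
Proof.
move=> k_gt0; have [phi phiP H] := definable_accept.
(* The computation starts with all heads at one node. Variable 0 is the first source variable, and
   the first disjunct excuses the source tuples that are not constant; the universal closure then
   asks for acceptance from every node. *)
pose psi := Or (Not (eqs Sigma k (xv k) (nseq k 0))) (exs (yv k) phi).
exists (alls (fv psi) psi); split; last 1 first.
- move=> g; rewrite models_alls.
  have holdsE (f : nat -> g) : holds f psi <->
      (map f (xv k) = map f (nseq k 0) -> holds f (exs (yv k) phi)).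
    rewrite -(@holds_eqs _ k) ?size_nseq ?size_tuple //.
    change (holds f psi) with (~~ holds f (eqs Sigma k (xv k) (nseq k 0)) ||
      holds f (exs (yv k) phi)).
    by case: holds; split=> // ->.
  have accE (e : nat -> g) : map e (xv k) = map e (nseq k 0) ->
      acc A (e 0) <-> holds e (exs (yv k) phi).
    move=> xE; have Eu : map_tuple e (xv k) = [tuple e 0 | _ < k].
      apply: eq_from_tnth => i; rewrite tnth_mktuple tnth_xv.
      have := congr1 (fun s => nth (e 0) s i) xE.
      rewrite (nth_map 0) ?size_tuple // (nth_map 0) ?size_nseq //.
      by rewrite nth_nseq ltn_ord -tnth_nth tnth_mktuple.
    have lx z : z \in xv k -> z \notin yv k by rewrite mem_xv mem_yv; lia.
    have ly z : z \in yv k -> z < k + (k + k) by rewrite mem_yv; lia.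
    rewrite holds_exs ?uniq_yv //; split.
      move=> [q [v [qA /(reachable_macro (pebs k X e)) uv qv]]]; exists v.
        by rewrite !size_tuple.
      apply/H; rewrite bind_tuple_id ?uniq_yv // bind_tuple_notin // bind_pebs // Eu.
      by exists q.
    move=> [s]; rewrite (size_tuple (yv k)) => /eqP Es; set v := Tuple Es.
    move=> /H; rewrite -[s]/(tval v) bind_tuple_id ?uniq_yv // bind_tuple_notin //.
    rewrite bind_pebs // Eu => -[q qA [/reachable_macro uv qv]].
    by exists q, v.
  split=> [L e|M u]; first by apply/holdsE => xE; apply/accE.
  have xE : map (fun _ => u) (xv k) = map (fun _ => u) (nseq k 0).
    have mapu (s : seq nat) : map (fun _ => u) s = nseq (size s) u by elim: s => //= x s ->.
    by rewrite !mapu size_nseq size_tuple.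
  by apply/(accE (fun _ => u) xE); move/holdsE: (M (fun _ => u)); exact.
- by apply/FO_DTC_alls; split; [exact: FO_DTC_eqs | apply/FO_DTC_exs].
- exact: closed_alls.
Qed.

End AutomatonToFormula.

(** * Machines *)

Section Machines.
Variables (Sigma X : finType) (k : nat) (t0 : test Sigma X k).

(** A state carries one instruction, a test together with both its outcomes, so the automaton read
    off a machine is deterministic by construction. *)
Inductive minstr (S R : Type) : Type :=
| MRet of R
| MAct of action Sigma X k & S
| MTest of test Sigma X k & S & S.
Arguments MRet {S R}.
Arguments MAct {S R}.
Arguments MTest {S R}.

(* A machine is a flowchart with exits labelled in [R]; deterministic automata are
   assembled from machines with [mbind] and [miter]. *)
Record machine (R : Type) :=
  Machine { mst : finType; mtr : mst -> minstr mst R; ment : mst }.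

Definition conf (g : graph Sigma) := (k.-tuple g * seq (X * g))%type.

(** Only runs that reach an exit are considered: a machine that loops or meets an inapplicable
    action has none. *)
Inductive runs_from (R S : Type) (tr : S -> minstr S R) (g : graph Sigma) :
  S -> conf g -> R -> conf g -> Prop :=
| runs_ret s r c : tr s = MRet r -> runs_from tr s c r c
| runs_act s a s' c c1 r c' : tr s = MAct a s' ->
    exec a c.1 c.2 c1.1 c1.2 -> runs_from tr s' c1 r c' -> runs_from tr s c r c'
| runs_test s t s1 s2 c r c' : tr s = MTest t s1 s2 ->
    runs_from tr (if eval_test t c.1 c.2 then s1 else s2) c r c' ->
    runs_from tr s c r c'.

Notation runs m := (@runs_from _ _ (@mtr _ m) _).

(* Partial correctness, and also termination if [tot]. *)
Definition spec (tot : bool) R (m : machine R) g (c : conf g)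
    (post : R -> conf g -> Prop) : Prop :=
  (tot -> exists r c', runs m (ment m) c r c') /\
  forall r c', runs m (ment m) c r c' -> post r c'.

Lemma spec_conseq tot R (m : machine R) g (c : conf g) post post' :
  spec tot m c post -> (forall r c', post r c' -> post' r c') ->
  spec tot m c post'.
Proof. by move=> [T P] H; split=> // r c' /P /H. Qed.

Lemma spec_total tot R (m : machine R) g (c : conf g) post :
  spec true m c post -> spec tot m c post.
Proof. by move=> [T P]; split=> // _; exact: T. Qed.

Definition mret R (r : R) : machine R := @Machine R unit (fun _ => MRet r) tt.

Definition mact (a : action Sigma X k) : machine unit :=
  @Machine unit bool (fun b => if b then MAct a false else MRet tt) true.

Definition mtest (t : test Sigma X k) : machine bool :=
  @Machine bool (option bool)
    (fun s => if s is Some b then MRet b else MTest t (Some true) (Some false)) None.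

Definition mmap R R' (h : R -> R') (m : machine R) : machine R' :=
  @Machine R' (mst m) (fun s => match mtr s with
    | MRet r => MRet (h r)
    | MAct a s' => MAct a s'
    | MTest t s1 s2 => MTest t s1 s2
    end) (ment m).

Section Iter.
Variables (Q : finType) (R : Type) (body : Q -> machine (Q + R)).

Definition iter_state : finType := {q : Q & mst (body q)}.

(* [t0] is irrelevant: this is a silent transition. *)
Definition iter_jump (q : Q) : minstr iter_state R :=
  let s := Tagged (fun q => mst (body q)) (ment (body q)) in MTest t0 s s.

Definition iter_mtr (s : iter_state) : minstr iter_state R :=
  let: existT q s := s in
  match mtr s with
  | MRet (inl q') => iter_jump q'
  | MRet (inr r) => MRet r
  | MAct a s' => MAct a (Tagged (fun q => mst (body q)) s')
  | MTest t s1 s2 => MTest t (Tagged (fun q => mst (body q)) s1)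
                             (Tagged (fun q => mst (body q)) s2)
  end.

Definition miter (q : Q) : machine R :=
  @Machine R iter_state iter_mtr (Tagged (fun q => mst (body q)) (ment (body q))).

End Iter.

(** Sequencing as an iteration of two rounds: round [None] runs [m], round [Some r] runs [f r]. The
    intermediate result is remembered in the control state, hence the finite type [R1]. *)
Definition mbind (R1 : finType) R2 (m : machine R1) (f : R1 -> machine R2) :
    machine R2 :=
  @miter (option R1) R2 (fun q =>
    if q is Some r then mmap inr (f r) else mmap (fun r => inl (Some r)) m) None.

Lemma runs_inv R S (tr : S -> minstr S R) g s (c : conf g) r c' :
  runs_from tr s c r c' ->
  match tr s with
  | MRet r1 => r = r1 /\ c' = c
  | MAct a s' => exists2 c1 : conf g, exec a c.1 c.2 c1.1 c1.2 & runs_from tr s' c1 r c'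
  | MTest t s1 s2 => runs_from tr (if eval_test t c.1 c.2 then s1 else s2) c r c'
  end.
Proof.
by case=> {s c r c'} [s r c E|s a s' c c1 r c' E ac H|s t s1 s2 c r c' E H];
  rewrite E //; exists c1.
Qed.

Lemma spec_ret tot R (r : R) g (c : conf g) (post : R -> conf g -> Prop) :
  post r c -> spec tot (mret r) c post.
Proof.
move=> P; split=> [_|r' c' H]; first by exists r, c; exact: runs_ret.
by have [-> ->] := runs_inv H.
Qed.

Lemma spec_act tot a g (c : conf g) (post : unit -> conf g -> Prop) :
  (exists c' : conf g, exec a c.1 c.2 c'.1 c'.2) ->
  (forall c' : conf g, exec a c.1 c.2 c'.1 c'.2 -> post tt c') ->
  spec tot (mact a) c post.
Proof.
move=> [c1 ac1] P; split=> [_|r' c' H]; last first.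
  have [c2 ac2 H2] := runs_inv H; have [-> ->] := runs_inv H2; exact: P.
exists tt, c1; apply: (@runs_act _ _ (@mtr _ (mact a)) _ true a false _ _ _ _ erefl ac1).
exact: runs_ret.
Qed.

Lemma spec_test tot t g (c : conf g) (post : bool -> conf g -> Prop) :
  post (eval_test t c.1 c.2) c -> spec tot (mtest t) c post.
Proof.
move=> P; split=> [_|r' c' H0].
  exists (eval_test t c.1 c.2), c.
  apply: (@runs_test _ _ (@mtr _ (mtest t)) _ None t (Some true) (Some false)) => //.
  by apply: runs_ret; case: eval_test.
by have /= := runs_inv H0; case: eval_test P => P H; have [-> ->] := runs_inv H.
Qed.

Lemma runs_mmap R R' (h : R -> R') m g s (c : conf g) r' c' :
  runs (mmap h m) s c r' c' <-> exists2 r, r' = h r & runs m s c r c'.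
Proof.
split=> [H|[r -> H]].
  elim: H => {s c r' c'} [s r' c /=|s a s' c c1 r' c' /=|s t s1 s2 c r' c' /=];
    case E: (@mtr _ m s) => [r|a1 s1'|t1 s1' s2'] //.
  - by case=> <-; exists r => //; exact: runs_ret.
  - by case=> <- <- ac _ [r2 -> H]; exists r2 => //; exact: runs_act ac H.
  - by case=> <- <- <- _ [r2 -> H]; exists r2 => //; exact: runs_test H.
elim: H => {s c r c'} [s r c E|s a s' c c1 r c' E ac _ IH|s t s1 s2 c r c' E _ IH].
- by apply: runs_ret; rewrite /= E.
- by apply: runs_act ac IH; rewrite /= E.
- by apply: (@runs_test _ _ (@mtr _ (mmap h m)) _ s t s1 s2) => //; rewrite /= E.
Qed.

Lemma spec_mmap tot R R' (h : R -> R') m g (c : conf g) post :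
  spec tot m c (fun r => post (h r)) -> spec tot (mmap h m) c post.
Proof.
move=> [T P]; split=> [/T[r [c' H]]|r' c' /runs_mmap[r -> /P]] //.
by exists (h r), c'; apply/runs_mmap; exists r.
Qed.

Section IterSpec.
Variables (Q : finType) (R : Type) (body : Q -> machine (Q + R)).
Variable g0 : graph Sigma.
Implicit Types (g : graph Sigma).
Notation tg s := (Tagged (fun q => mst (body q)) s : iter_state body).

Lemma runs_iter q g (s : mst (body q)) (c : conf g) x c1 :
  runs_from (@mtr _ (body q)) s c x c1 ->
  match x with
  | inl q' => forall r c', runs_from (@iter_mtr _ _ body) (tg (ment (body q'))) c1 r c' ->
                runs_from (@iter_mtr _ _ body) (tg s) c r c'
  | inr r => runs_from (@iter_mtr _ _ body) (tg s) c r c1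
  end.
Proof.
elim=> {s c x c1} [s x c E|s a s' c c1 x c' E ac _ IH|s t s1 s2 c x c' E _ IH].
- case: x E => [q' E r c' H|r E]; last by apply: runs_ret; rewrite /= E.
  apply: (@runs_test _ _ (@iter_mtr _ _ body) _ (tg s) t0
     (tg (ment (body q'))) (tg (ment (body q')))); first by rewrite /= E.
  by rewrite if_same.
- case: x IH => [q' IH r c2 H|r IH].
    by apply: (@runs_act _ _ (@iter_mtr _ _ body) _ (tg s) a (tg s') _ _ _ _ _ ac (IH _ _ H)); rewrite /= E.
  by apply: (@runs_act _ _ (@iter_mtr _ _ body) _ (tg s) a (tg s') _ _ _ _ _ ac IH); rewrite /= E.
- case: x IH => [q' IH r c2 H|r IH].
    apply: (@runs_test _ _ (@iter_mtr _ _ body) _ (tg s) t (tg s1) (tg s2)); first by rewrite /= E.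
    by have := IH _ _ H; case: eval_test.
  apply: (@runs_test _ _ (@iter_mtr _ _ body) _ (tg s) t (tg s1) (tg s2)); first by rewrite /= E.
  by move: IH; case: eval_test.
Qed.

Lemma runs_iter_inv g (st : iter_state body) (c : conf g) r c' :
  runs_from (@iter_mtr _ _ body) st c r c' ->
  runs_from (@mtr _ (body _)) (tagged st) c (inr r) c' \/
  exists q' c1, runs_from (@mtr _ (body _)) (tagged st) c (inl q') c1 /\
                runs_from (@iter_mtr _ _ body) (tg (ment (body q'))) c1 r c'.
Proof.
elim=> {st c r c'} [[q s] r c /=|[q s] a s' c c1 r c' /=|[q s] t s1 s2 c r c' /=];
  case E: (mtr s) => [[q'|r1]|a1 s1'|t1 s1' s2'] //.
- by case=> <-; left; exact: runs_ret.
- case=> <- <- ac _ [H|[q' [c2 [H H']]]]; [left|right]; first exact: runs_act ac H.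
  by exists q', c2; split=> //; exact: runs_act ac H.
- case=> _ <- <-; rewrite !if_same => H _; right; exists q', c; split=> //.
  exact: runs_ret.
- case=> <- <- <- _ IH.
  set s' := if eval_test t1 c.1 c.2 then s1' else s2'.
  have {IH} : runs_from (@mtr _ (body _)) s' c (inr r) c' \/
    exists q' c1, runs_from (@mtr _ (body _)) s' c (inl q') c1 /\
      runs_from (@iter_mtr _ _ body) (tg (ment (body q'))) c1 r c'.
    by rewrite /s'; case: eval_test IH.
  move=> [H|[q' [c2 [H H']]]]; [left|right]; first exact: runs_test H.
  by exists q', c2; split=> //; exact: runs_test H.
Qed.

Lemma spec_iter_unfold tot q g (c : conf g) (post : R -> conf g -> Prop) :
  spec tot (body q) c (fun x c1 => match x with
    | inl q' => spec tot (miter body q') c1 post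
    | inr r => post r c1 end) ->
  spec tot (miter body q) c post.
Proof.
move=> [T P]; split=> [t|r c' H].
  have [x [c1 H]] := T t; have := P _ _ H; have := runs_iter H.
  case: x {H} => [q' Hr [/(_ t)[r [c' H]] _]|r H _]; last by exists r, c1.
  by exists r, c'; exact: Hr.
have [H1|[q' [c1 [H1 H2]]]] := runs_iter_inv H; first exact: P H1.
by have [_] := P _ _ H1; exact.
Qed.

(** Loop rule with invariant [I], whose measure [n] has to decrease only if termination is claimed.
    Termination is by induction on [n], partial correctness by induction on the run. *)
Lemma spec_iter tot (I : nat -> Q -> conf g0 -> Prop) n q (c : conf g0)
    (post : R -> conf g0 -> Prop) :
  (forall n q c, I n q c -> spec tot (body q) c (fun x c1 => match x with
     | inl q' => exists2 n', tot -> n' < n & I n' q' c1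
     | inr r => post r c1 end)) ->
  I n q c -> spec tot (miter body q) c post.
Proof.
move=> step Iq; split=> [t|r c' H].
  elim/ltn_ind: n q c Iq => n IH q c /step[/(_ t)[x [c1 H]] P].
  have := P _ _ H; have := runs_iter H; case: x {H} => [q' Hr [n' /(_ t) ltn Iq']|r H _].
    by have [r [c' /Hr H]] := IH n' ltn q' c1 Iq'; exists r, c'.
  by exists r, c1.
(* The induction passes through states in the middle of a round, so the invariant is replaced by
   what it implies for the remainder of the round. *)
suff gen st d : runs_from (@iter_mtr _ _ body) st d r c' ->
    (forall x c1, runs_from (@mtr _ (body _)) (tagged st) d x c1 -> match x with
       | inl q' => exists n, I n q' c1 | inr r => post r c1 end) -> post r c'.
  apply: gen H _ => x c1 /(step _ _ _ Iq).2.
  by case: x => // q' [n' _ In']; exists n'.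
elim=> {st d c' H}
  [[p s] {}r d /=|[p s] a s' d d1 {}r c' /= + ac _ IH|[p s] t s1 s2 d {}r c' /= + _ IH];
  case E: (mtr s) => [[q'|r1]|a1 s1'|t1 s1' s2'] //.
- by case=> <- P; apply: (P (inr r1)); exact: runs_ret.
- case=> Ea Es P; rewrite -{}Ea in ac; rewrite -{}Es in IH.
  by apply: IH => x c1 H; apply: P; exact: runs_act ac H.
- case=> _ E1 E2 P; have [n' Iq'] := P (inl q') d (runs_ret _ E).
  rewrite -E1 -E2 if_same in IH; apply: IH => x c1 /(step _ _ _ Iq').2.
  by case: x => // q2 [n2 _ In2]; exists n2.
- case=> Et E1 E2 P; rewrite -{}Et -{}E1 -{}E2 in IH; apply: IH => x c1 H.
  by apply: P; apply: runs_test E _; case: eval_test H.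
Qed.

End IterSpec.

Lemma spec_bind tot (R1 : finType) R2 (m : machine R1) (f : R1 -> machine R2)
    g (c : conf g) (post : R2 -> conf g -> Prop) :
  spec tot m c (fun r c1 => spec tot (f r) c1 post) ->
  spec tot (mbind m f) c post.
Proof.
move=> mS; apply: spec_iter_unfold; apply: spec_mmap.
apply: spec_conseq mS _ => r c1 fS; apply: spec_iter_unfold.
exact: spec_mmap.
Qed.

Definition machine_instr (m : machine bool) (p : mst m) (a : action Sigma X k)
    (q : mst m) : bool :=
  match mtr p with
  | MRet _ => false
  | MAct a' q' => (a == a') && (q == q')
  | MTest t s1 s2 => (a == Test t) && (q == s1) || (a == NegTest t) && (q == s2)
  end.

Definition machine_accepting (m : machine bool) : {set mst m} :=
  [set s | if mtr s is MRet r then r else false].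

Definition machine_automaton (m : machine bool) : automaton Sigma k :=
  Automaton (ment m) (machine_accepting m) (@machine_instr m).

Lemma machine_automaton_det m : deterministic (machine_automaton m).
Proof.
move=> p a1 q1 a2 q2; rewrite /= /machine_instr.
case: (mtr p) => // [a q /andP[/eqP-> /eqP->] /andP[/eqP-> /eqP->] //|t s1 s2].
case/orP=> /andP[/eqP-> /eqP->] /orP[] /andP[/eqP-> /eqP->] //= _; exists t; by [left | right].
Qed.

Lemma acc_machine (m : machine bool) (g : graph Sigma) (u : g) : acc (machine_automaton m) u ->
  exists v : k.-tuple g, runs m (ment m) ([tuple u | _ < k], [::]) true (v, [::]).
Proof.
move=> [q [v [qA /reachable_star uv _]]]; exists v.
pose P (c : config (machine_automaton m) g) := runs m (cstate c) (heads c, stack c) true (v, [::]).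
suff: P (start (machine_automaton m) u) by [].
move: uv; apply: star_ind_left => [|[p w st] [p' w' st'] [a pa ac] _].
  move: qA; rewrite inE /P /=; case E: (@mtr _ m q) => [r||] // rT.
  by apply: runs_ret; rewrite E rT.
rewrite /P /= in pa ac *; move: pa; rewrite /machine_instr.
case E: (@mtr _ m p) => [r|a' q'|t s1 s2] //.
  by case/andP=> /eqP Ea /eqP-> H; rewrite Ea in ac; apply: runs_act E _ H.
case/orP=> /andP[/eqP Ea /eqP->] H; rewrite Ea in ac.
  by case: ac => tw Ew Est; rewrite Ew Est in H; apply: runs_test E _; rewrite tw.
by case: ac => tw Ew Est; rewrite Ew Est in H; apply: runs_test E _; rewrite (negPf tw).
Qed.

Lemma machine_acc (m : machine bool) (g : graph Sigma) (u : g) (v : k.-tuple g) :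
  runs m (ment m) ([tuple u | _ < k], [::]) true (v, [::]) ->
  acc (machine_automaton m) u.
Proof.
pose A := machine_automaton m.
suff gen s (c : conf g) r c' : runs m s c r c' -> r = true -> exists q,
    [/\ q \in accepting A, halting (Config q c'.1 c'.2 : config A g) &
      star (@step _ _ A g) (Config (s : state A) c.1 c.2) (Config q c'.1 c'.2)].
  move=> /gen/(_ erefl)[q [qA qh uq]]; exists q, v; split=> //.
  exact/reachable_star.
elim=> {s c r c'} [s r c E|s a s' c c1 r c' E ac _ IH|s t s1 s2 c r c' E _ IH] rT.
- exists s; split; last exact: star_refl.
    by rewrite inE E rT.
  by move=> d [a /=]; rewrite /machine_instr E.
- have [q [qA qh sq]] := IH rT; exists q; split=> //; apply: star_left sq.
  by exists a => //=; rewrite /machine_instr E !eqxx.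
- have [q [qA qh sq]] := IH rT; exists q; split=> //; apply: star_left sq.
  case tc: (eval_test t c.1 c.2).
    by exists (Test t) => //=; rewrite /machine_instr E !eqxx.
  by exists (NegTest t) => //=; rewrite ?tc // /machine_instr E !eqxx orbT.
Qed.

End Machines.

(** * Depth-first traversal of a functional graph *)

Section Tour.
Variables (T : finType) (R : rel T) (key : T -> nat) (u v : T).
Hypothesis R_fun : forall a b c, R a b -> R a c -> b = c.
Hypothesis key_inj : injective key.

(** Edges leaving [v] are cut. As [R] is functional, the nodes that lead to [v] then form a tree
    rooted at [v], even when [v] lies on a cycle of [R]. *)
Definition child c b := R c b && (c != v).

Definition sibling a c :=
  [&& c != v, key a < key c & [exists p, R a p && R c p]].

Definition least (P : pred T) c := P c /\ forall d, P d -> key c <= key d.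

(* [tour true a r] and [tour false a r]: the depth-first traversal, from [v], of
   the tree of all nodes that lead to [v], with children ordered by [key], ends
   with the answer [r] when continued after entering, resp. leaving, [a]. *)
Inductive tour : bool -> T -> bool -> Prop :=
| tour_found : tour true u true
| tour_down a c r : a != u -> least (child^~ a) c -> tour true c r -> tour true a r
| tour_leaf a r : a != u -> (forall c, ~~ child c a) -> tour false a r -> tour true a r
| tour_root : tour false v false
| tour_next a c r : a != v -> least (sibling a) c -> tour true c r -> tour false a r
| tour_up a p r : a != v -> (forall c, ~~ sibling a c) -> R a p ->
    tour false p r -> tour false a r.

Lemma exists_least (P : pred T) c : P c -> exists d, least P d.
Proof.
by move=> Pc; case: (arg_minnP key Pc) => d Pd dmin; exists d; split.
Qed.

(** A cycle through [b] could be shifted along the unique path from [b] to [v], but no [child] edge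
    leaves [v]. *)
Lemma child_acyclic b c : connect child b v -> child c b -> ~ connect child b c.
Proof.
have child_fun x y z : child x y -> child x z -> y = z.
  by move=> /andP[xy _] /andP[xz _]; exact: R_fun xy xz.
have stepP x y : connect child x y -> x = y \/ exists2 z, child x z & connect child z y.
  move=> /connect_star xy; case: (star_cases xy) => [->|[z xz zy]]; [by left | right].
  by exists z => //; apply/connect_star.
move=> /connect_star bv; move: b bv c.
apply: (@star_ind_left _ _ _ (fun b => forall c, child c b -> ~ connect child b c))
  => [c cv /stepP[vc|[z /andP[_ /eqP]]]|b b1 bb1 _ IH c cb /stepP[bc|[z bz zc]]] //.
- by move: cv; rewrite -vc => /andP[_ /eqP].
- by apply: (IH b bb1); rewrite -bc in cb; rewrite (child_fun _ _ _ bb1 cb).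
- rewrite (child_fun _ _ _ bz bb1) in zc.
  by apply: (IH b bb1); apply: connect_trans zc (connect1 cb).
Qed.

Lemma sibling_child a b c : child a b -> sibling a c = child c b && (key a < key c).
Proof.
move=> /andP[ab _]; rewrite /sibling /child.
have -> : [exists p, R a p && R c p] = R c b.
  apply/existsP/idP => [[p /andP[ap cp]]|cb]; first by rewrite (R_fun ab ap).
  by exists b; rewrite ab.
by case: (c != v); case: (R c b); case: (_ < _).
Qed.

(** Induction on the number of nodes below [b]: a subtree that is entered either contains [u], which
    is then found, or is left again through its root. Inner inductions run through the children of
    [b] by increasing [key]. *)
Lemma tour_subtree b : connect child b v ->
  (connect child u b -> tour true b true) /\
  (~~ connect child u b -> forall r, tour false b r -> tour true b r).
Proof.
have [n] := ubnP #|[set x | connect child x b]|.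
elim: n b => // n IH b ltn bv.
have {}IH c : child c b ->
    (connect child u c -> tour true c true) /\
    (~~ connect child u c -> forall r, tour false c r -> tour true c r).
  move=> cb; apply: IH; last by apply: connect_trans bv; exact: connect1.
  rewrite -ltnS (leq_trans _ ltn) // ltnS proper_card //; apply/properP; split.
    by apply/subsetP => x; rewrite !inE => xc; apply: connect_trans xc (connect1 cb).
  by exists b; rewrite inE ?connect0 //; apply/negP; exact: child_acyclic cb.
have nv c : child c b -> c != v by case/andP.
split=> [ub|nub r br].
  have [->|bu] := eqVneq b u; first exact: tour_found.
  have [c0 uc0 c0b] : exists2 c0, connect child u c0 & child c0 b.
    move: ub => /connect_star; move Ez: b => z uz.
    case: uz Ez => [Ez|y {}z uy yz Ez]; first by rewrite Ez eqxx in bu.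
    by exists y; [apply/connect_star | rewrite ?Ez].
  (* [c0] is the child above [u]; the children before it are entered and left in turn, which the
     distance of their keys to [key c0] measures. *)
  suff H c : child c b -> key c <= key c0 -> tour true c true.
    have [c [cb cmin]] := exists_least (P := child^~ b) c0b.
    apply: tour_down bu (conj cb cmin) _; exact: H (cmin _ c0b).
  have [m] := ubnP (key c0 - key c); elim: m c => // m IHm c ltm cb cc0.
  have [uc|nuc] := boolP (connect child u c); first exact: (IH _ cb).1.
  apply: (IH _ cb).2 => //.
  have [Ec|ne] := eqVneq c c0; first by move: nuc; rewrite Ec uc0.
  have ltc : key c < key c0 by rewrite ltn_neqAle cc0 andbT; apply: contraNneq ne => /key_inj->.
  have [|d [cd dmin]] := @exists_least (sibling c) c0.
    by rewrite (sibling_child _ cb) c0b.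
  have /dmin dc0 : sibling c c0 by rewrite (sibling_child _ cb) c0b.
  apply: tour_next (nv _ cb) (conj cd dmin) _; move: cd; rewrite (sibling_child _ cb).
  by case/andP=> db ltd; apply: IHm => //; lia.
have nuc c : child c b -> ~~ connect child u c.
  by move=> cb; apply: contraNN nub => uc; apply: connect_trans uc (connect1 cb).
have key_max c : key c <= \max_c key c by exact: leq_bigmax.
have H c : child c b -> tour true c r.
  have [m] := ubnP (\max_c key c - key c); elim: m c => // m IHm c ltm cb.
  apply: (IH _ cb).2; first exact: nuc.
  have [/existsP[d0 cd0]|/existsPn none] := boolP [exists d, sibling c d].
    have [d [cd dmin]] := exists_least cd0.
    apply: tour_next (nv _ cb) (conj cd dmin) _; move: cd; rewrite (sibling_child _ cb).
    by case/andP=> db ltd; apply: IHm => //; have := key_max d; lia.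
  by apply: tour_up (nv _ cb) none _ br; case/andP: cb.
have bu : b != u by apply: contraNneq nub => ->.
have [/existsP[c0 c0b]|/existsPn none] := boolP [exists c, child c b].
  have [c [cb cmin]] := exists_least (P := child^~ b) c0b.
  exact: tour_down bu (conj cb cmin) (H _ cb).
exact: tour_leaf bu none br.
Qed.

(** A path of [R] to [v] can be cut at its first visit to [v], after which it consists of [child]
    edges. *)
Lemma tour_connect : tour true v (connect R u v).
Proof.
have -> : connect R u v = connect child u v.
  apply/idP/idP; last by apply: connect_sub => a b /andP[ab _]; exact: connect1.
  move=> /connect_star; move: u; apply: star_ind_left => [|a b ab _ bv]; first exact: connect0.
  have [->|av] := eqVneq a v; first exact: connect0.
  by apply: connect_trans bv; apply: connect1; rewrite /child ab av.
have [uv nuv] := tour_subtree (connect0 _ v).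
by case: (boolP (connect child u v)) => [/uv //|/nuv]; apply; exact: tour_root.
Qed.

End Tour.

(** * Programs with pebbles *)

Section Programs.
Variables (Sigma X : finType) (k : nat) (t0 : test Sigma X k).
Implicit Types (g : graph Sigma).
Local Notation mach := (machine Sigma X k).

Definition names (Y : Type) g (st : seq (Y * g)) : seq Y := [seq p.1 | p <- st].

Lemma mem_names (Y : eqType) g (st : seq (Y * g)) x (v : g) : (x, v) \in st -> x \in names st.
Proof. by move=> xv; apply/mapP; exists (x, v). Qed.

Lemma uniq_names_inj (Y : eqType) g (st : seq (Y * g)) x v w : uniq (names st) ->
  (x, v) \in st -> (x, w) \in st -> v = w.
Proof.
elim: st => //= [[y z] st IH] /andP[yst /IH{}IH]; rewrite !inE !xpair_eqE.
have [->|_] /= := eqVneq x y; last by [].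
case/orP=> [/eqP->|/mem_names]; last by rewrite (negPf yst).
by case/orP=> [/eqP->//|/mem_names]; rewrite (negPf yst).
Qed.

Lemma exec_uniq_names (Y : finType) g (a : action Sigma Y k) (u : k.-tuple g) st u' st' :
  exec a u st u' st' -> uniq (names st) -> uniq (names st').
Proof.
case: a => [i s|i s|i x|x|i x|t|t] /=.
- by move=> [v [_ _ ->]].
- by move=> [v [_ _ ->]].
- by move=> [xst _ ->] /= ->; rewrite andbT.
- by move=> [_ [v ->]] /= /andP[].
- by move=> [v [_ _ ->]].
- by move=> [_ _ ->].
- by move=> [_ _ ->].
Qed.

Definition mseq R (m1 : mach unit) (m2 : mach R) : mach R := mbind t0 m1 (fun _ => m2).

Lemma spec_seq tot R (m1 : mach unit) (m2 : mach R) g (c : conf X k g) post :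
  spec tot m1 c (fun _ c1 => spec tot m2 c1 post) -> spec tot (mseq m1 m2) c post.
Proof. by move=> H; apply: spec_bind; apply: spec_conseq H _. Qed.

Definition mif R (m : mach bool) (m1 m2 : mach R) : mach R :=
  mbind t0 m (fun r => if r then m1 else m2).

Lemma spec_if tot R (m : mach bool) (m1 m2 : mach R) g (c : conf X k g) post :
  spec tot m c (fun r c1 => spec tot (if r then m1 else m2) c1 post) ->
  spec tot (mif m m1 m2) c post.
Proof. exact: spec_bind. Qed.

Lemma spec_jump tot i x g (v : g) (u : k.-tuple g) st
    (post : unit -> conf X k g -> Prop) :
  uniq (names st) -> (x, v) \in st -> post tt (move_head u i v, st) ->
  spec tot (mact (Jump Sigma i x)) (u, st) post.
Proof.
move=> Ust xv P; apply: spec_act => [|[u' st'] /= [w [xw -> ->]]].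
  by exists (move_head u i v, st), v.
by rewrite (uniq_names_inj Ust xw xv).
Qed.

Lemma spec_drop tot i (x : X) g (u : k.-tuple g) st
    (post : unit -> conf X k g -> Prop) :
  x \notin names st -> post tt (u, (x, tnth u i) :: st) ->
  spec tot (mact (Drop Sigma i x)) (u, st) post.
Proof.
move=> xst P; apply: spec_act => [|[u' st'] /= [_ -> ->]] //.
by exists (u, (x, tnth u i) :: st).
Qed.

Lemma spec_retrieve tot (x : X) g (v : g) (u : k.-tuple g) st
    (post : unit -> conf X k g -> Prop) :
  post tt (u, st) -> spec tot (mact (Retrieve Sigma k x)) (u, (x, v) :: st) post.
Proof.
move=> P; apply: spec_act => [|[u' st'] /= [-> [w [_ <-]]]] //.
by exists (u, st); split=> //; exists v.
Qed.

Lemma spec_outmove tot i s g (v : g) (u : k.-tuple g) st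
    (post : unit -> conf X k g -> Prop) :
  edg s (tnth u i) v -> post tt (move_head u i v, st) ->
  spec tot (mact (OutMove X i s)) (u, st) post.
Proof.
move=> sv P; apply: spec_act => [|[u' st'] /= [w [sw -> ->]]].
  by exists (move_head u i v, st), v.
by rewrite (edg_out_unique sw sv).
Qed.

Lemma spec_inmove tot i s g (v : g) (u : k.-tuple g) st
    (post : unit -> conf X k g -> Prop) :
  edg s v (tnth u i) -> post tt (move_head u i v, st) ->
  spec tot (mact (InMove X i s)) (u, st) post.
Proof.
move=> sv P; apply: spec_act => [|[u' st'] /= [w [sw -> ->]]].
  by exists (move_head u i v, st), v.
by rewrite (edg_in_unique sw sv).
Qed.

Definition jumpall (pe : 'I_k -> X) : mach unit :=
  foldr (fun j => mseq (mact (Jump Sigma j (pe j)))) (mret _ _ _ tt) (enum 'I_k).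

Lemma spec_jumpall tot pe g (c u : k.-tuple g) st (post : unit -> conf X k g -> Prop) :
  uniq (names st) -> (forall j, (pe j, tnth c j) \in st) -> post tt (c, st) ->
  spec tot (jumpall pe) (u, st) post.
Proof.
move=> Ust pec P; rewrite /jumpall.
(* Generalized for the induction: heads that are no longer on the list are in place already. *)
have : forall j, j \notin enum 'I_k -> tnth u j = tnth c j by move=> j; rewrite mem_enum.
elim: (enum 'I_k) u => [|j l IH] u ul /=.
  by have -> : u = c; [apply: eq_from_tnth => j; exact: ul | exact: spec_ret].
apply: spec_seq; apply: spec_jump (pec j) _ => //; apply: IH => i il.
rewrite tnth_move_head; case: eqVneq => [->//|ij]; apply: ul.
by rewrite inE negb_or ij.
Qed.

(** Reversed because the pebble dropped last is on top of the stack. *)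
Definition saved (pe : 'I_k -> X) g (u : k.-tuple g) : seq (X * g) :=
  rev [seq (pe j, tnth u j) | j <- enum 'I_k].

Definition dropall (pe : 'I_k -> X) : mach unit :=
  foldr (fun j => mseq (mact (Drop Sigma j (pe j)))) (mret _ _ _ tt) (enum 'I_k).

Lemma spec_dropall tot pe g (u : k.-tuple g) st
    (post : unit -> conf X k g -> Prop) :
  injective pe -> (forall j, pe j \notin names st) ->
  post tt (u, saved pe u ++ st) -> spec tot (dropall pe) (u, st) post.
Proof.
move=> pe_inj pe_st; rewrite /saved /dropall.
have : forall j, j \in enum 'I_k -> pe j \notin names st by move=> j _.
elim: (enum 'I_k) (enum_uniq 'I_k) st {pe_st} => [|j l IH] /= Ul st lst P; first exact: spec_ret.
have /andP[jl {}Ul] := Ul.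
apply: spec_seq; apply: spec_drop; first by apply: lst; rewrite inE eqxx.
apply: IH => // [i il|]; last by move: P; rewrite rev_cons cat_rcons.
rewrite inE negb_or lst ?inE ?il ?orbT // andbT.
by apply: contraNneq jl => /pe_inj <-.
Qed.

Definition popall (l : seq X) : mach unit :=
  foldr (fun x => mseq (mact (Retrieve Sigma k x))) (mret _ _ _ tt) l.

Lemma spec_popall tot g (s : seq (X * g)) (u : k.-tuple g) st
    (post : unit -> conf X k g -> Prop) :
  post tt (u, st) -> spec tot (popall (names s)) (u, s ++ st) post.
Proof.
move=> P; elim: s => [|[x v] s IH]; first exact: spec_ret.
by apply: spec_seq; apply: spec_retrieve.
Qed.

Definition saved_names (pe : 'I_k -> X) : seq X := rev [seq pe j | j <- enum 'I_k].

Lemma names_saved pe g (u : k.-tuple g) : names (saved pe u) = saved_names pe.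
Proof. by rewrite /names map_rev -map_comp. Qed.

Lemma mem_saved pe g (u : k.-tuple g) j : (pe j, tnth u j) \in saved pe u.
Proof. by rewrite mem_rev; apply/mapP; exists j; rewrite ?mem_enum. Qed.

Lemma spec_pop_saved tot pe g (u w : k.-tuple g) st (post : unit -> conf X k g -> Prop) :
  post tt (u, st) -> spec tot (popall (saved_names pe)) (u, saved pe w ++ st) post.
Proof. by move=> P; rewrite -(names_saved pe w); exact: spec_popall. Qed.

End Programs.

(** * Searching a graph with the guide *)

Section Search.
Variables (Sigma : finType) (k : nat) (i0 : 'I_k) (G : automaton Sigma k) (D : nat).
Hypotheses (dG : deterministic G) (jG : jump_free G).
Implicit Types (g : graph Sigma).

(* Pebbles are stratified into levels: at each level there is a copy of the
   pebbles of the guide, and one pebble for each head. *)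
Definition X : finType := ('I_D.+1 * (pebble G + 'I_k))%type.
Definition PG b y : X := (inord b, inl y).
Definition PS b j : X := (inord b, inr j).
Definition t0 : test Sigma X k := PebAt Sigma i0 (PS 0 i0).

Local Notation mach := (machine Sigma X k).
Local Notation "m1 ;; m2" := (mseq t0 m1 m2) (at level 60, right associativity).
Local Notation cfg g := (conf X k g).

(** The invariant behind nested searches: when everything on the stack lies below level [b], all
    pebbles of level [b] are free to be dropped. *)
Definition valid b g (st : seq (X * g)) :=
  uniq (names st) && all (fun p : X * g => nat_of_ord p.1.1 < b) st.

Lemma valid_uniq b g (st : seq (X * g)) : valid b st -> uniq (names st).
Proof. by case/andP. Qed.

Lemma valid_fresh b g (st : seq (X * g)) z : b <= D -> valid b st ->
  (inord b, z) \notin names st.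
Proof.
move=> bD /andP[_ /allP lev]; apply/mapP => -[[x v] /lev + /= Ex].
by rewrite -Ex /= inordK ?ltnn.
Qed.

Lemma valid_leq b b' g (st : seq (X * g)) : b <= b' -> valid b st -> valid b' st.
Proof.
move=> bb' /andP[U /allP lev]; apply/andP; split=> //.
by apply/allP => p /lev ltb; exact: leq_trans ltb bb'.
Qed.

Lemma PS_inj b : injective (PS b). Proof. by move=> i j []. Qed.
Lemma PG_inj b : injective (PG b). Proof. by move=> i j []. Qed.

Definition emb b g (gst : seq (pebble G * g)) : seq (X * g) :=
  [seq (PG b p.1, p.2) | p <- gst].

Lemma names_emb b g (gst : seq (pebble G * g)) : names (emb b gst) = map (PG b) (names gst).
Proof. by rewrite /names /emb -!map_comp. Qed.

Lemma mem_emb b g (gst : seq (pebble G * g)) st y v : b <= D -> valid b st ->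
  ((PG b y, v) \in emb b gst ++ st) = ((y, v) \in gst).
Proof.
move=> bD Vst; rewrite mem_cat orbC.
case: (boolP (_ \in st)) => [/mem_names|_ /=].
  by rewrite (negPf (valid_fresh _ bD Vst)).
by apply/mapP/idP => [[[y' v'] yv [-> ->]] //|yv]; exists (y, v).
Qed.

Lemma emb_fresh b g (gst : seq (pebble G * g)) st y : b <= D -> valid b st ->
  (PG b y \in names (emb b gst ++ st)) = (y \in names gst).
Proof.
move=> bD Vst; rewrite {1}/names map_cat mem_cat -!/(names _) names_emb.
rewrite mem_map; last exact: PG_inj.
by rewrite (negPf (valid_fresh _ bD Vst)) orbF.
Qed.

Lemma valid_emb b g (gst : seq (pebble G * g)) st : b <= D -> valid b st ->
  uniq (names gst) -> valid b.+1 (emb b gst ++ st).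
Proof.
move=> bD Vst Ug; have /andP[Ust /allP lev] := Vst; apply/andP; split.
  rewrite /names map_cat -!/(names _) cat_uniq Ust andbT names_emb.
  rewrite (map_inj_uniq (PG_inj (b := b))) Ug /=; apply/hasPn => x xst.
  apply/mapP => -[y _ Ex]; rewrite Ex in xst.
  by rewrite (negPf (valid_fresh _ bD Vst)) in xst.
apply/allP => p; rewrite mem_cat => /orP[/mapP[q _ ->]|/lev/ltnW] //=.
by rewrite inordK.
Qed.

Lemma valid_saved b g (gst : seq (pebble G * g)) st (u : k.-tuple g) :
  b <= D -> valid b st -> uniq (names gst) ->
  valid b.+1 (saved (PS b) u ++ emb b gst ++ st).
Proof.
move=> bD Vst Ug; have /andP[U lev] := valid_emb bD Vst Ug; apply/andP; split.
  rewrite /names map_cat -!/(names _) cat_uniq U andbT names_saved rev_uniq.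
  rewrite map_inj_uniq ?enum_uniq; last exact: PS_inj.
  apply/hasPn => x xst /=; rewrite mem_rev; apply/mapP => -[j _ Ex].
  move: xst; rewrite Ex /names map_cat -!/(names _) mem_cat.
  rewrite (negPf (valid_fresh _ bD Vst)) orbF names_emb.
  by case/mapP => y.
rewrite all_cat lev andbT all_rev; apply/allP => p /mapP[j _ ->] /=.
by rewrite inordK.
Qed.

Definition gtest b (t : test Sigma (pebble G) k) : test Sigma X k :=
  match t with
  | LabAt i s => LabAt _ i s
  | PebAt i x => PebAt _ i (PG b x)
  | InEdge i s => InEdge _ i s
  | OutEdge i s => OutEdge _ i s
  end.

Definition gact b (a : action Sigma (pebble G) k) : action Sigma X k :=
  match a with
  | InMove i s => InMove _ i s
  | OutMove i s => OutMove _ i s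
  | Drop i x => Drop _ i (PG b x)
  | Retrieve x => Retrieve _ _ (PG b x)
  | Jump i x => Jump _ i (PG b x)
  | Test t => Test (gtest b t)
  | NegTest t => NegTest (gtest b t)
  end.

Definition gnames (a : action Sigma (pebble G) k) nm :=
  match a with
  | Drop _ x => x :: nm
  | Retrieve _ => behead nm
  | _ => nm
  end.

Definition mnot (m : mach bool) : mach bool := mmap negb m.

(** Applicability is decided beforehand, so that the simulation notices when the guide halts instead
    of getting stuck itself. *)
Definition gappl b (nm : seq (pebble G)) (a : action Sigma (pebble G) k) : mach bool :=
  match a with
  | InMove i s => mtest (InEdge _ i s)
  | OutMove i s => mtest (OutEdge _ i s)
  | Drop i x => mret _ _ _ (x \notin nm)
  | Retrieve x => mret _ _ _ (ohead nm == Some x)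
  | Jump i x => mret _ _ _ (x \in nm)
  | Test t => mtest (gtest b t)
  | NegTest t => mnot (mtest (gtest b t))
  end.

(** * One action of the guide, simulated with the pebbles of level [b] *)

Section Simulation.
Variables (g : graph Sigma) (b : nat) (st : seq (X * g)).
Hypotheses (bD : b <= D) (Vst : valid b st).

Lemma eval_gtest t (u : k.-tuple g) gst :
  eval_test (gtest b t) u (emb b gst ++ st) = eval_test t u gst.
Proof. by case: t => //= i x; rewrite mem_emb. Qed.

Lemma spec_gappl tot (a : action Sigma (pebble G) k) (u : k.-tuple g)
    (gst : seq (pebble G * g)) (post : bool -> cfg g -> Prop) :
  (forall r : bool, (r <-> exists u' gst', exec a u gst u' gst') ->
     post r (u, emb b gst ++ st)) ->
  spec tot (gappl b (names gst) a) (u, emb b gst ++ st) post.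
Proof.
move=> H; case: a H => [i s|i s|i x|x|i x|t|t] /= H.
- apply: spec_test; apply: H => /=; split=> [/existsP[v sv]|[u' [gst' [v [sv _ _]]]]].
    by exists (move_head u i v), gst, v.
  by apply/existsP; exists v.
- apply: spec_test; apply: H => /=; split=> [/existsP[v sv]|[u' [gst' [v [sv _ _]]]]].
    by exists (move_head u i v), gst, v.
  by apply/existsP; exists v.
- apply: spec_ret; apply: H; split=> [xn|[u' [gst' []]] //].
  by exists u, ((x, tnth u i) :: gst).
- apply: spec_ret; apply: H; split.
    by case: gst => //= -[y v] gst /eqP[->]; exists u, gst; split=> //; exists v.
  by move=> [u' [gst' [_ [v ->]]]] /=.
- apply: spec_ret; apply: H; split=> [/mapP[[y v] yv /= ->]|].
    by exists (move_head u i v), gst, v.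
  by move=> [u' [gst' [v [/mem_names]]]].
- apply: spec_test; apply: H; rewrite eval_gtest; split=> [tu|[u' [gst' []]] //].
  by exists u, gst.
- apply: spec_mmap; apply: spec_test; apply: H; rewrite eval_gtest.
  by split=> [tu|[u' [gst' []]] //]; exists u, gst.
Qed.

Lemma spec_gact tot (a : action Sigma (pebble G) k) (u : k.-tuple g)
    (gst : seq (pebble G * g)) (post : unit -> cfg g -> Prop) :
  (exists u' gst', exec a u gst u' gst') ->
  (forall u' gst', exec a u gst u' gst' -> names gst' = gnames a (names gst) ->
     post tt (u', emb b gst' ++ st)) ->
  spec tot (mact (gact b a)) (u, emb b gst ++ st) post.
Proof.
move=> [u1 [gst1 E1]] H; apply: spec_act => [|[u2 st2] E2 /=].
  exists (u1, emb b gst1 ++ st); case: a E1 {H} => [i s|i s|i x|x|i x|t|t] /=.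
  - by move=> [v [sv -> ->]]; exists v.
  - by move=> [v [sv -> ->]]; exists v.
  - move=> [xn -> ->]; split=> //.
    by have := emb_fresh gst x bD Vst; rewrite /names => ->.
  - by move=> [-> [v ->]]; split=> //; exists v.
  - by move=> [v [xv -> ->]]; exists v; rewrite mem_emb.
  - by move=> [tu -> ->]; rewrite eval_gtest.
  - by move=> [tu -> ->]; rewrite eval_gtest.
case: a E1 E2 H => [i s|i s|i x|x|i x|t|t] /= E1 E2 H.
- by move: E2 => [v [sv -> ->]]; apply: H => //; exists v.
- by move: E2 => [v [sv -> ->]]; apply: H => //; exists v.
- move: E1 => [xn _ _]; move: E2 => [_ -> ->].
  by apply: (H _ ((x, tnth u i) :: gst)).
- move: E1 => [_ [v Eg]]; move: E2 => [-> [w]]; rewrite Eg /= => -[_ <-].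
  by apply: (H _ gst1); rewrite ?Eg //; split=> //; exists v.
- move: E2 => [v []]; rewrite mem_emb // => xv -> ->.
  by apply: H => //; exists v.
- by move: E1 => [tu _ _]; move: E2 => [_ -> ->]; apply: H.
- by move: E1 => [tu _ _]; move: E2 => [_ -> ->]; apply: H.
Qed.

End Simulation.

(* The names on the guide's stack are kept in the control state, since no test tells
   whether a pebble can be dropped or retrieved. *)
Definition gstate : finType := (state G * #|pebble G|.-bseq (pebble G))%type.

Definition gpair (q : state G) (nm : seq (pebble G)) : gstate := (q, insub_bseq _ nm).

(** Distinct names fit into the bounded sequence, so the default of [insub_bseq] does not arise. *)
Lemma gpair_names q nm : uniq nm -> (gpair q nm).2 = nm :> seq _.
Proof.
move=> U; rewrite /gpair /insub_bseq insubdK //.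
by rewrite unfold_in /= -(card_uniqP U) max_card.
Qed.

Definition gtry b (nm : seq (pebble G)) : seq (action Sigma (pebble G) k * state G) ->
    mach (option gstate) :=
  foldr (fun aq m => mif t0 (gappl b nm aq.1)
           (mact (gact b aq.1) ;; mret _ _ _ (Some (gpair aq.2 (gnames aq.1 nm)))) m)
        (mret _ _ _ None).

Definition gstep b (q : gstate) : mach (option gstate) :=
  gtry b q.2 [seq aq <- enum {: action Sigma (pebble G) k * state G} | instr q.1 aq.1 aq.2].

Lemma spec_gstep tot b g (st : seq (X * g)) p (u : k.-tuple g) gst
    (post : option gstate -> cfg g -> Prop) :
  b <= D -> valid b st -> uniq (names gst) ->
  (forall q u' gst', step (Config p u gst) (Config q u' gst') ->
     uniq (names gst') -> post (Some (gpair q (names gst'))) (u', emb b gst' ++ st)) ->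
  (halting (Config p u gst) -> post None (u, emb b gst ++ st)) ->
  spec tot (gstep b (gpair p (names gst))) (u, emb b gst ++ st) post.
Proof.
move=> bD Vst Ug Pstep Phalt; rewrite /gstep gpair_names //=.
set l := filter _ _.
have l_in aq : aq \in l -> instr p aq.1 aq.2 by rewrite mem_filter => /andP[].
have {Phalt} : (forall aq u' gst', aq \in l -> ~ exec aq.1 u gst u' gst') ->
    post None (u, emb b gst ++ st).
  move=> H; apply: Phalt => -[q u' gst'] [a /= pa]; apply: (H (a, q)).
  by rewrite mem_filter pa mem_enum.
elim: l l_in => [|[a q] l IH] l_in Phalt /=; first by apply: spec_ret; exact: Phalt.
apply: spec_if; apply: spec_gappl => // -[] rP.
  apply: spec_seq; apply: spec_gact => //; first exact/rP.
  move=> u' gst' E <-; apply: spec_ret; apply: Pstep.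
    by exists a => //; apply: (l_in (a, q)); rewrite mem_head.
  exact: exec_uniq_names E Ug.
apply: IH => [aq aql|H]; first by apply: l_in; rewrite inE aql orbT.
apply: Phalt => aq u' gst'; rewrite inE => /predU1P[->|]; last exact: H.
by move=> E; have /rP: exists u' gst', exec a u gst u' gst' by exists u', gst'.
Qed.

(** [trace o l c]: the guide started at [o] reaches [c], and [l] lists the positions of its heads
    before [c]. Dually, [rest c s] says that the guide halts from [c] and that [s] lists the
    positions from [c] on. So [rest (start G o) vl] means that the guide halts, [vl] being its
    enumeration of nodes, with repetitions. *)
Inductive trace g (o : g) : seq g -> config G g -> Prop :=
| trace_start : trace o [::] (start G o)
| trace_step l c c' : trace o l c -> step c c' -> trace o (l ++ heads c) c'.

Inductive rest g : config G g -> seq g -> Prop :=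
| rest_halt c : halting c -> rest c (heads c)
| rest_step c c' s : step c c' -> rest c' s -> rest c (heads c ++ s).

(** For an arbitrary configuration the stack might hold a pebble at two nodes, which would make a
    jump ambiguous; the guide has no jumps. *)
Lemma guide_step_fun g (c c1 c2 : config G g) : step c c1 -> step c c2 -> c1 = c2.
Proof.
case: c c1 c2 => [p u st] [q1 u1 st1] [q2 u2 st2] [a1 /= i1 e1] [a2 /= i2 e2].
have [[Ea Eq]|opp] := det_instr dG i1 i2; last by case: (opposite_exec opp e1 e2).
rewrite -{}Ea -{}Eq in e2 i2 *; suff [-> ->] : u1 = u2 /\ st1 = st2 by [].
case: a1 i1 e1 e2 {i2} => [i s|i s|i x|x|i x|t|t] i1 /=.
- by move=> [v [sv -> ->]] [w [sw -> ->]]; rewrite (edg_in_unique sv sw).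
- by move=> [v [sv -> ->]] [w [sw -> ->]]; rewrite (edg_out_unique sv sw).
- by move=> [_ -> ->] [_ -> ->].
- by move=> [-> [v ->]] [-> [w [_ ->]]].
- by have := jG p i x q1; rewrite i1.
- by move=> [_ -> ->] [_ -> ->].
- by move=> [_ -> ->] [_ -> ->].
Qed.

Lemma rest_inv g (c : config G g) s : rest c s -> halting c /\ s = heads c \/
  exists c' s', [/\ step c c', rest c' s' & s = heads c ++ s'].
Proof. by case=> [{}c hc|{}c c' s' cc' rs']; [left | right; exists c', s']. Qed.

Lemma trace_rest g (o : g) l c s : trace o l c -> rest c s -> rest (start G o) (l ++ s).
Proof.
move=> tr; elim: tr s => {l c} [|l c c' _ IH cc'] s // rs.
by rewrite -catA; apply: IH; exact: rest_step cc' rs.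
Qed.

Lemma rest_trace g (o : g) l c s : trace o l c -> rest (start G o) s ->
  exists2 s', rest c s' & s = l ++ s'.
Proof.
move=> tr rs; elim: tr => {l c} [|l c c' _ [s' rs' Es] cc']; first by exists s.
case/rest_inv: rs' => [[hc _]|[c2 [s2 [cc2 rs2 Es']]]]; first by case: (hc _ cc').
by exists s2; rewrite ?(guide_step_fun cc' cc2) // Es Es' catA.
Qed.

Lemma rest_heads g (c : config G g) s : rest c s -> exists s', s = heads c ++ s'.
Proof. by case=> [{}c _|{}c c' {}s _ _]; [exists [::]; rewrite cats0 | exists s]. Qed.

Lemma rest_fun g (c : config G g) s s' : rest c s -> rest c s' -> s = s'.
Proof.
move=> cs; elim: cs s' => {c s} [c hc|c c' s cc' _ IH] s'.
  by case/rest_inv => [[_ ->]|[c' [s1 [cc' _ _]]]] //; case: (hc c').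
case/rest_inv => [[hc _]|[c1 [s1 [cc1 rs1 ->]]]]; first by case: (hc c').
by rewrite (IH s1) // (guide_step_fun cc' cc1).
Qed.

Fixpoint mfirst (l : seq 'I_k) (B : 'I_k -> mach bool) : mach bool :=
  if l is i :: l' then mif t0 (B i) (mret _ _ _ true) (mfirst l' B) else mret _ _ _ false.

(** One round per configuration of the guide. The pebbles dropped at its heads are what [B]
    inspects, and they also let the guide resume after [B] has moved the heads. *)
Definition search_body b (B : X -> mach bool) (q : gstate) : mach (gstate + bool) :=
  dropall t0 (PS b) ;;
  mif t0 (mfirst (enum 'I_k) (fun i => B (PS b i)))
    (popall t0 (saved_names (PS b)) ;; popall t0 (map (PG b) q.2) ;; mret _ _ _ (inr true))
    (jumpall t0 (PS b) ;; popall t0 (saved_names (PS b)) ;;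
     mbind t0 (gstep b q) (fun r => if r is Some q' then mret _ _ _ (inl q')
       else popall t0 (map (PG b) q.2) ;; mret _ _ _ (inr false))).

(* The guide runs from the node of [po]; when [B] answers [true] the search stops
   and leaves the heads where [B] put them, which is how a found tuple is passed on
   while the pebbles of the search are retrieved. *)
Definition search b po (B : X -> mach bool) : mach bool :=
  jumpall t0 (fun _ => po) ;; miter t0 (search_body b B) (gpair (init G) [::]).

Lemma spec_mfirst (tot : bool) g (st : seq (X * g)) (u w : k.-tuple g) B 
    (Q : g -> k.-tuple g -> Prop) (N : g -> Prop) l (post : bool -> cfg g -> Prop) :
  (forall i u', spec tot (B i) (u', st) (fun r c => c.2 = st /\
     if r then Q (tnth w i) c.1 else N (tnth w i))) ->
  (forall pre i suf u', l = pre ++ i :: suf -> (forall j, j \in pre -> N (tnth w j)) ->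
     Q (tnth w i) u' -> post true (u', st)) ->
  (forall u', (forall j, j \in l -> N (tnth w j)) -> post false (u', st)) ->
  spec tot (mfirst l B) (u, st) post.
Proof.
move=> HB; elim: l u => [|i l IH] u Pt Pf /=; first by apply: spec_ret; exact: Pf.
apply: spec_if; apply: spec_conseq (HB i u) _ => -[] [u' st'] /= [->].
  by move=> Qi; apply: spec_ret; apply: (Pt [::] i l).
move=> Ni; apply: IH => [pre j suf u2 El npre Qj|u2 nl].
  apply: (Pt (i :: pre) j suf) => // [|a]; first by rewrite El.
  by rewrite inE => /predU1P[->|/npre].
by apply: Pf => j; rewrite inE => /predU1P[->|/nl].
Qed.

(** [Q v u'] is what a positive answer of [B] at node [v] says of the heads [u'] it leaves behind,
    [N v] what a negative answer says. A positive outcome comes from the first success and needs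
    only a trace, so it makes sense even if the guide would not halt; a negative one entails that
    the guide has halted. *)
Lemma spec_search (tot : bool) b po (B : X -> mach bool) g (o : g) (u : k.-tuple g) st 
    (Q : g -> k.-tuple g -> Prop) (N : g -> Prop) (post : bool -> cfg g -> Prop) :
  b <= D -> valid b st -> (po, o) \in st ->
  (tot -> exists vl, rest (start G o) vl) ->
  (forall x v u' st', valid b.+1 st' -> {subset st <= st'} -> (x, v) \in st' ->
     spec tot (B x) (u', st') (fun r c => c.2 = st' /\
       if r then Q v c.1 else N v)) ->
  (forall l c pre v suf u', trace o l c -> l ++ heads c = pre ++ v :: suf ->
     (forall w, w \in pre -> N w) -> Q v u' -> post true (u', st)) ->
  (forall vl u', rest (start G o) vl -> (forall w, w \in vl -> N w) ->
     post false (u', st)) ->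
  spec tot (search b po B) (u, st) post.
Proof.
move=> bD Vst poo halts HB Pt Pf.
apply: spec_seq; apply: (@spec_jumpall _ _ _ _ _ _ _ [tuple o | _ < k]).
- exact: valid_uniq Vst.
- by move=> j; rewrite tnth_mktuple.
(* The measure [n] is the number of entries of the enumeration still to come. *)
pose I n (q : gstate) (c : cfg g) := exists p w gst l,
  [/\ q = gpair p (names gst), c = (w, emb b gst ++ st), uniq (names gst),
      trace o l (Config p w gst) /\ (forall v, v \in l -> N v)
    & tot -> exists2 s, size s = n & rest (Config p w gst) s].
have [n nP] : exists n, tot -> exists2 s, size s = n & rest (start G o) s.
  have [t|nt] := boolP tot; last by exists 0.
  by have [vl rvl] := halts t; exists (size vl) => _; exists vl.
apply: (@spec_iter _ _ _ _ _ _ _ _ tot I n); last first.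
  exists (init G), [tuple o | _ < k], [::], [::]; split=> //.
  by split=> //; exact: trace_start.
move=> {n nP} n q c [p [w [gst [l [-> -> Ug [tr nl] rs]]]]].
have Vst' := valid_saved w bD Vst Ug.
have sub : {subset st <= saved (PS b) w ++ emb b gst ++ st}.
  by move=> x xst; rewrite !mem_cat xst !orbT.
have Vemb := valid_emb bD Vst Ug.
have heads_pre (pre suf : seq 'I_k) i : enum 'I_k = pre ++ i :: suf ->
    w = map (tnth w) pre ++ tnth w i :: map (tnth w) suf :> seq _.
  by move=> E; rewrite -[LHS]map_tnth_enum E map_cat.
apply: spec_seq; apply: spec_dropall => [|j|]; first exact: PS_inj.
  rewrite /names map_cat -!/(names _) mem_cat names_emb negb_or (valid_fresh _ bD Vst) andbT.
  by apply/mapP => -[].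
apply: spec_if; apply: (@spec_mfirst _ _ _ _ w _ Q N).
- move=> i u'; apply: HB => //; by rewrite mem_cat mem_saved.
- move=> pre i suf u' El npre Qi.
  apply: spec_seq; apply: spec_pop_saved; apply: spec_seq.
  rewrite gpair_names // -names_emb; apply: spec_popall; apply: spec_ret.
  apply: (Pt _ _ (l ++ map (tnth w) pre) (tnth w i) (map (tnth w) suf) _ tr) => //.
    by rewrite -catA /= -heads_pre.
  by move=> v; rewrite mem_cat => /orP[/nl//|/mapP[j /npre nNj ->]].
move=> u' nw; have nheads v : v \in w -> N v.
  by move=> /tnthP[j ->]; apply: nw; rewrite mem_enum.
apply: spec_seq; apply: (@spec_jumpall _ _ _ _ _ _ _ w).
- exact: valid_uniq Vst'.
- by move=> j; rewrite mem_cat mem_saved.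
apply: spec_seq; apply: spec_pop_saved; apply: spec_bind; apply: spec_gstep => //.
  move=> q' w' gst' st1 Ug'; apply: spec_ret.
  have [n' ltn rs'] : exists2 n', tot -> n' < n &
      tot -> exists2 s, size s = n' & rest (Config q' w' gst') s.
    have [t|nt] := boolP tot; last by exists 0.
    have [s <- /rest_inv[[hs _]|[c2 [s2 [cc2 rs2 ->]]]]] := rs t; first by case: (hs _ st1).
    rewrite (guide_step_fun cc2 st1) in rs2.
    exists (size s2) => _; last by exists s2.
    (* A round uses up [k] entries, and [k] is positive because [i0] exists. *)
    by rewrite size_cat size_tuple -addn1 addnC leq_add2r (leq_trans _ (ltn_ord i0)).
  exists n' => //; exists q', w', gst', (l ++ w); split=> //; split.
    exact: trace_step tr st1.
  by move=> v; rewrite mem_cat => /orP[/nl|/nheads].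
move=> hc; apply: spec_seq; rewrite gpair_names // -names_emb; apply: spec_popall.
apply: spec_ret; apply: Pf (trace_rest tr (rest_halt hc)) _ => v.
by rewrite mem_cat => /orP[/nl|/nheads].
Qed.

Definition goodfrom g (o : g) :=
  exists2 vl, rest (start G o) vl & forall v : g, v \in vl.

Definition good g := forall o : g, goodfrom o.

(** Nothing is promised about the final position of the heads, and nothing is assumed about the
    initial one. *)
Definition computes (m : mach bool) g (st : seq (X * g)) (r : bool) :=
  forall u, spec true m (u, st) (fun r' c => c.2 = st /\ r' = r).

Lemma computes_not m g (st : seq (X * g)) r : computes m st r -> computes (mnot m) st (~~ r).
Proof.
by move=> mr u; apply: spec_mmap; apply: spec_conseq (mr u) _ => r' c [-> ->].
Qed.

Definition mand m1 m2 : mach bool := mif t0 m1 m2 (mret _ _ _ false).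
Definition mor m1 m2 : mach bool := mif t0 m1 (mret _ _ _ true) m2.

Lemma computes_and m1 m2 g (st : seq (X * g)) r1 r2 :
  computes m1 st r1 -> computes m2 st r2 -> computes (mand m1 m2) st (r1 && r2).
Proof.
move=> H1 H2 u; apply: spec_if; apply: spec_conseq (H1 u) _ => r [u' st'] /= [-> ->].
by case: r1 {H1}; [exact: H2 | exact: spec_ret].
Qed.

Lemma computes_or m1 m2 g (st : seq (X * g)) r1 r2 :
  computes m1 st r1 -> computes m2 st r2 -> computes (mor m1 m2) st (r1 || r2).
Proof.
move=> H1 H2 u; apply: spec_if; apply: spec_conseq (H1 u) _ => r [u' st'] /= [-> ->].
by case: r1 {H1}; [exact: spec_ret | exact: H2].
Qed.

Definition pos g (st : seq (X * g)) (pe : seq X) (c : seq g) :=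
  (size pe == size c) && all (mem st) (zip pe c).

Lemma pos_cat g (st : seq (X * g)) pe c qe d :
  pos st pe c -> pos st qe d -> pos st (pe ++ qe) (c ++ d).
Proof.
move=> /andP[/eqP Es pc] /andP[/eqP Es' qd].
by rewrite /pos !size_cat Es Es' eqxx zip_cat // all_cat pc.
Qed.

Lemma pos_sub g (st st' : seq (X * g)) pe c :
  {subset st <= st'} -> pos st pe c -> pos st' pe c.
Proof.
by move=> sub /andP[Es /allP pc]; rewrite /pos Es; apply/allP => p /pc; exact: sub.
Qed.

Lemma pos_nth g (st : seq (X * g)) pe c x0 v0 i :
  pos st pe c -> i < size c -> (nth x0 pe i, nth v0 c i) \in st.
Proof.
move=> /andP[/eqP Es /allP pc] lti; rewrite -nth_zip //; apply: pc.
by rewrite mem_nth // size_zip Es minnn.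
Qed.

Lemma pos_bind g (st : seq (X * g)) (xs : seq nat) pe c rho e z :
  pos st pe c -> size c = size xs -> (forall z, (rho z, e z) \in st) ->
  (bind rho xs pe z, bind e xs c z) \in st.
Proof.
move=> pc Es re; have /andP[/eqP Ep _] := pc; rewrite /bind.
have [lti|lei] := ltnP (index z xs) (size c); first exact: pos_nth.
by rewrite !nth_default ?Ep.
Qed.

Definition load (pe : seq X) := jumpall t0 (fun j => nth (PS 0 i0) pe j).

Lemma spec_load tot g (u c : k.-tuple g) pe st (post : unit -> cfg g -> Prop) :
  uniq (names st) -> pos st pe c -> post tt (c, st) -> spec tot (load pe) (u, st) post.
Proof.
move=> Ust pc P; apply: spec_jumpall P => // j.
by rewrite (tnth_nth (tnth c i0)); apply: pos_nth => //; rewrite size_tuple.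
Qed.

Definition heads_at (pe : seq X) : mach bool :=
  foldr (fun j => mand (mtest (PebAt _ j (nth (PS 0 i0) pe j)))) (mret _ _ _ true)
    (enum 'I_k).

Lemma spec_heads_at tot g (u c : k.-tuple g) pe st (post : bool -> cfg g -> Prop) :
  uniq (names st) -> pos st pe c -> post (u == c) (u, st) ->
  spec tot (heads_at pe) (u, st) post.
Proof.
move=> Ust pc; have -> : (u == c) = all (fun j => tnth u j == tnth c j) (enum 'I_k).
  apply/eqP/allP => [-> //|H]; apply: eq_from_tnth => j; apply/eqP/H.
  by rewrite mem_enum.
rewrite /heads_at; elim: (enum _) => [|j l IH] /= P; first exact: spec_ret.
apply: spec_if; apply: spec_test => /=.
have -> : (nth (PS 0 i0) pe j, tnth u j) \in st = (tnth u j == tnth c j).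
  have pj : (nth (PS 0 i0) pe j, tnth c j) \in st.
    by rewrite (tnth_nth (tnth c i0)); apply: pos_nth => //; rewrite size_tuple.
  by apply/idP/eqP => [puj|-> //]; exact: uniq_names_inj Ust puj pj.
by move: P; case: (tnth u j == tnth c j) => P; [exact: IH | exact: spec_ret].
Qed.

Definition same pe qe : mach bool := load pe ;; heads_at qe.

Lemma computes_same g (c d : k.-tuple g) pe qe st :
  uniq (names st) -> pos st pe c -> pos st qe d -> computes (same pe qe) st (c == d).
Proof.
move=> Ust pc qd u; apply: spec_seq; apply: spec_load pc _ => //.
exact: spec_heads_at qd _.
Qed.

(* [acc] lists the pebbles already placed. *)
Fixpoint msearch n b po (acc : seq X) (B : seq X -> mach bool) : mach bool :=
  if n is n'.+1 then search b po (fun x => msearch n' b.+1 po (rcons acc x) B)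
  else B acc.

(** On success the tuple is loaded while its pebbles are still on the stack, so the heads keep it
    when the searches are unwound. *)
Definition mfind b po (B : seq X -> mach bool) : mach bool :=
  msearch k b po [::] (fun pe => mif t0 (B pe) (load pe ;; mret _ _ _ true) (mret _ _ _ false)).

(* Which of two tuples comes first is decided by searching for either. *)
Definition less b po pe qe : mach bool :=
  mand (mnot (same pe qe))
    (mif t0 (mfind b po (fun re => mor (same re pe) (same re qe)))
       (heads_at pe) (mret _ _ _ false)).

Definition px b : seq X := [seq PS b j | j <- enum 'I_k].

(** [mfind] has removed all pebbles above level [b], so those of the current tuple are on top and
    can be moved to the heads. *)
Definition replace b := popall t0 (saved_names (PS b)) ;; dropall t0 (PS b).
Definition finish b (r : bool) : mach (bool + bool) :=
  popall t0 (saved_names (PS b)) ;; mret _ _ _ (inr r).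

(* One step of [tour]: the current node is at the pebbles of level [b]. *)
Definition tour_body b po (Rm : nat -> seq X -> seq X -> mach bool) pu pv (down : bool) :
    mach (bool + bool) :=
  (* Level [b] holds the current tuple, and each component of the tuple sought takes one level from
     [b.+1] on; [b1] is the next free level. *)
  let b1 := b.+1 + k in
  if down then
    mif t0 (same (px b) pu) (finish b true)
      (mif t0 (mfind b.+1 po (fun pc => mand (Rm b1 pc (px b)) (mnot (same pc pv))))
         (replace b ;; mret _ _ _ (inl true)) (mret _ _ _ (inl false)))
  else
    mif t0 (same (px b) pv) (finish b false)
      (mif t0 (mfind b.+1 po (fun pc =>
           mand (mnot (same pc pv)) (mand (less b1 po (px b) pc)
             (msearch k b1 po [::] (fun pp =>
                mand (Rm (b1 + k) (px b) pp) (Rm (b1 + k) pc pp))))))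
         (replace b ;; mret _ _ _ (inl true))
         (mif t0 (mfind b.+1 po (fun pp => Rm b1 (px b) pp))
            (replace b ;; mret _ _ _ (inl false)) (finish b false))).

Definition mclosure b po Rm pu pv : mach bool :=
  load pv ;; dropall t0 (PS b) ;; miter t0 (tour_body b po Rm pu pv) true.

(** * Evaluation on a graph that the guide searches completely *)

Section Total.
Variables (g : graph Sigma) (o : g) (po : X) (vl : seq g).
Hypotheses (vl_rest : rest (start G o) vl) (vl_all : forall v : g, v \in vl).

Lemma spec_search_total b B (u : k.-tuple g) st
    (Q : g -> k.-tuple g -> Prop) (N : g -> Prop) (post : bool -> cfg g -> Prop) :
  b <= D -> valid b st -> (po, o) \in st ->
  (forall x v u' st', valid b.+1 st' -> {subset st <= st'} -> (x, v) \in st' ->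
     spec true (B x) (u', st') (fun r c => c.2 = st' /\ if r then Q v c.1 else N v)) ->
  (forall pre v suf u', vl = pre ++ v :: suf -> (forall w, w \in pre -> N w) ->
     Q v u' -> post true (u', st)) ->
  (forall u', (forall w, w \in vl -> N w) -> post false (u', st)) ->
  spec true (search b po B) (u, st) post.
Proof.
move=> bD Vst poo HB Pt Pf; apply: (@spec_search true b po B g o u st Q N) => //.
- by exists vl.
- move=> l c pre v suf u' tr El npre Qv.
  have [s /rest_heads[s' ->] Evl] := rest_trace tr vl_rest.
  by apply: (Pt pre v (suf ++ s')); rewrite // Evl catA El -catA.
- by move=> vl' u' r' nv; apply: Pf; rewrite (rest_fun vl_rest r').
Qed.

(** The order, with repetitions, in which [msearch] meets the tuples. *)
Fixpoint tups n : seq (seq g) :=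
  if n is n'.+1 then [seq v :: t | v <- vl, t <- tups n'] else [:: [::]].

Lemma mem_tups (t : seq g) : t \in tups (size t).
Proof.
elim: t => //= v t IH; apply/allpairsP; exists (v, t); split=> //=.
Qed.

Lemma spec_msearch n b acc a B (u : k.-tuple g) st
    (Q : seq g -> k.-tuple g -> Prop) (N : seq g -> Prop) (post : bool -> cfg g -> Prop) :
  b + n <= D.+1 -> valid b st -> (po, o) \in st -> pos st acc a ->
  (forall pe c u' st', valid (b + n) st' -> {subset st <= st'} -> pos st' pe c ->
     size c = size a + n ->
     spec true (B pe) (u', st') (fun r d => d.2 = st' /\ if r then Q c d.1 else N c)) ->
  (forall pre t suf u', tups n = pre ++ t :: suf -> (forall s, s \in pre -> N (a ++ s)) ->
     Q (a ++ t) u' -> post true (u', st)) ->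
  (forall u', (forall s, s \in tups n -> N (a ++ s)) -> post false (u', st)) ->
  spec true (msearch n b po acc B) (u, st) post.
Proof.
elim: n b acc a u st Q N post => [|n IH] b acc a u st Q N post bD Vst poo pa HB Pt Pf.
  rewrite addn0 in HB; have := HB acc a u st Vst (fun x xst => xst) pa (esym (addn0 _)).
  move=> H; apply: spec_conseq H _ => -[] [u' st'] /= [-> H].
    by apply: (Pt [::] [::] [::]); rewrite ?cats0.
  by apply: Pf => s; rewrite inE => /eqP->; rewrite cats0.
(* Success at [v] has to remember the first success among the tuples that begin with [v], so that it
   can be placed in the enumeration of the longer tuples. *)
pose Q' v u' := exists pre t suf, [/\ tups n = pre ++ t :: suf,
  forall s, s \in pre -> N (a ++ v :: s) & Q (a ++ v :: t) u'].
apply: (@spec_search_total _ _ _ _ Q' (fun v => forall t, t \in tups n -> N (a ++ v :: t)))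
  => //; first by lia.
- move=> x v u1 st1 V1 sub1 xv.
  apply: (IH b.+1 (rcons acc x) (rcons a v) u1 st1 Q N) => //.
  + by rewrite addSnnS.
  + exact: sub1.
  + by rewrite -!cats1; apply: pos_cat; [exact: pos_sub pa | rewrite /pos /= xv].
  + move=> pe c u2 st2 V2 sub2 pc Es; apply: HB => //.
    * by rewrite addnS -addSn.
    * by move=> y /sub1/sub2.
    * by rewrite Es size_rcons addSnnS.
  + move=> pre t suf u2 Et npre; rewrite cat_rcons => Qt; split=> //.
    by exists pre, t, suf; split=> // s /npre; rewrite cat_rcons.
  + by move=> u2 nt; split=> // t /nt; rewrite cat_rcons.
- move=> pre v suf u1 Evl npre [pre' [t [suf' [Et npre' Qt]]]].
  apply: (Pt ([seq w :: t | w <- pre, t <- tups n] ++ [seq v :: s | s <- pre']) (v :: t)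
    ([seq v :: s | s <- suf'] ++ [seq w :: t | w <- suf, t <- tups n])) => //.
    by rewrite /= Evl map_cat flatten_cat /= {2}Et map_cat -!catA.
  move=> s; rewrite mem_cat.
  move=> /orP[/allpairsP[[w t'] /= [/npre nw tn ->]]|/mapP[t' /npre' ? ->]] //.
  exact: nw.
- move=> u1 nv; apply: Pf => s /allpairsP[[w t'] /= [wv tn ->]]; exact: nv.
Qed.

Lemma computes_msearch n b B st (p : seq g -> bool) : b + n <= D.+1 ->
  valid b st -> (po, o) \in st ->
  (forall pe c st', valid (b + n) st' -> {subset st <= st'} -> pos st' pe c ->
     size c = n -> computes (B pe) st' (p c)) ->
  computes (msearch n b po [::] B) st (has p (tups n)).
Proof.
move=> bD Vst poo HB u; apply: (@spec_msearch n b [::] [::] B u st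
  (fun c _ => p c) (fun c => ~~ p c)) => //.
- move=> pe c u' st' V' sub pc Es; apply: spec_conseq (HB pe c st' V' sub pc Es u') _.
  by move=> r d [-> ->]; split=> //; case: ifP => // /negbT.
- move=> pre t suf u' Et _ pt; split=> //; apply/esym/hasP; exists t => //.
  by rewrite Et mem_cat mem_head orbT.
- by move=> u' np; split=> //; apply/esym/negbTE/hasPn.
Qed.

(** Position of the first occurrence; injective because every tuple occurs. *)
Definition key (t : k.-tuple g) := index (t : seq g) (tups k).

Lemma key_tups (t : k.-tuple g) : tval t \in tups k.
Proof. by rewrite -{2}(size_tuple t) mem_tups. Qed.

Lemma key_inj : injective key.
Proof.
move=> s t E; apply: val_inj => /=.
by rewrite -(nth_index [::] (key_tups s)) -/(key s) E nth_index ?key_tups.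
Qed.

(** Stopping at the first success yields the least [key], so an ordinary search finds the children
    and siblings required by [tour]. *)
Lemma key_least (P : pred (seq g)) pre (t : k.-tuple g) suf :
  tups k = pre ++ tval t :: suf -> (forall s, s \in pre -> ~~ P s) -> P t ->
  least key (fun c : k.-tuple g => P c) t.
Proof.
move=> Et npre Pt; split=> // d Pd; rewrite /key Et !index_cat.
have nt : tval t \notin pre by apply/negP => /npre; rewrite Pt.
have nd : tval d \notin pre by apply/negP => /npre; rewrite Pd.
by rewrite (negPf nt) (negPf nd) /= eqxx addn0 leq_addr.
Qed.

Lemma spec_mfind b B (u : k.-tuple g) st (p : pred (k.-tuple g)) (post : bool -> cfg g -> Prop) :
  b + k <= D.+1 -> valid b st -> (po, o) \in st ->
  (forall pe (c : k.-tuple g) st', valid (b + k) st' -> {subset st <= st'} -> pos st' pe c ->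
     computes (B pe) st' (p c)) ->
  (forall t : k.-tuple g, least key p t -> post true (t, st)) ->
  (forall u', (forall t : k.-tuple g, ~~ p t) -> post false (u', st)) ->
  spec true (mfind b po B) (u, st) post.
Proof.
move=> bD Vst poo HB Pt Pf.
(* [msearch] deals with sequences; those of length other than [k] get the default [false]. *)
pose P (s : seq g) := if insub s is Some t then p t else false.
have PE (t : k.-tuple g) : P t = p t by rewrite /P valK.
apply: (@spec_msearch k b [::] [::] _ u st (fun c u' => P c /\ tval u' = c) (fun c => ~~ P c)) => //.
- move=> pe c u' st' V' sub pc /= Es.
  have [t Et] : exists t : k.-tuple g, c = t by exists (Tuple (introT eqP Es)).
  rewrite {}Et in pc *; apply: spec_if; apply: spec_conseq (HB pe t st' V' sub pc u') _.
  move=> r [u1 st1] /= [-> ->]; case: ifP => pt.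
    apply: spec_seq; apply: spec_load pc _; first exact: valid_uniq V'.
    by apply: spec_ret; rewrite PE pt.
  by apply: spec_ret; rewrite PE pt.
- move=> pre t suf u' Et npre [Pt' /= Eu]; subst t.
  have [lu1 lu2] := key_least Et npre Pt'; apply: Pt; split; first by rewrite -PE.
  by move=> d pd; apply: lu2; rewrite PE.
- move=> u' nP; apply: Pf => t; rewrite -PE; apply: nP; exact: key_tups.
Qed.

Lemma computes_less b pe qe (c d : k.-tuple g) st :
  b + k <= D.+1 -> valid b st -> (po, o) \in st -> pos st pe c -> pos st qe d ->
  computes (less b po pe qe) st (key c < key d).
Proof.
move=> bD Vst poo pc qd.
have -> : (key c < key d) = ~~ (c == d) && (key c <= key d).
  by rewrite ltn_neqAle (inj_eq key_inj).
apply: computes_and; first by apply: computes_not; apply: computes_same (valid_uniq Vst) pc qd.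
move=> u; apply: spec_if.
apply: (@spec_mfind b _ u st (fun t => (t == c) || (t == d))) => //.
- move=> re t st' V' sub rt; apply: computes_or; apply: computes_same (valid_uniq V') rt _;
    exact: pos_sub sub _.
- move=> t [tcd tmin]; apply: spec_heads_at pc _; first exact: valid_uniq Vst.
  split=> //; have := tmin c; have := tmin d; rewrite !eqxx orbT => /(_ isT) td /(_ isT) tc.
  case: eqVneq tcd => [<- _|ne /= /eqP Et]; first by rewrite td.
  rewrite {}Et in ne tc; apply/esym/negbTE; rewrite -ltnNge ltn_neqAle tc andbT.
  by apply: contraNneq ne => /key_inj->.
- by move=> u' /(_ c); rewrite eqxx.
Qed.

(** * Deterministic closure by traversal *)

Section Closure.
Variables (b d : nat) (st : seq (X * g)) (R : rel (k.-tuple g)).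
Variables (Rm : nat -> seq X -> seq X -> mach bool).
Variables (u v : k.-tuple g) (pu pv : seq X).
Hypotheses (bD : (b.+1 + k) + k + d <= D) (Vst : valid b st) (poo : (po, o) \in st).
Hypotheses (puu : pos st pu u) (pvv : pos st pv v).
Hypothesis R_fun : forall x y z, R x y -> R x z -> y = z.
Hypothesis Rm_computes : forall c st' pe qe (x y : k.-tuple g), c + d <= D -> valid c st' ->
  {subset st <= st'} -> pos st' pe x -> pos st' qe y -> computes (Rm c pe qe) st' (R x y).

Lemma valid_saved_st (a : k.-tuple g) : valid b.+1 (saved (PS b) a ++ st).
Proof. by apply: (@valid_saved b g [::]) => //; lia. Qed.

Lemma pos_px (a : k.-tuple g) : pos (saved (PS b) a ++ st) (px b) a.
Proof.
rewrite /pos size_map size_enum_ord size_tuple eqxx /=.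
have -> : zip (px b) a = [seq (PS b j, tnth a j) | j <- enum 'I_k].
  by rewrite -[tval a in LHS]map_tnth_enum /px; elim: (enum _) => //= j l ->.
by apply/allP => p /mapP[j _ ->]; rewrite inE mem_cat mem_saved.
Qed.

Lemma sub_saved (a : k.-tuple g) : {subset st <= saved (PS b) a ++ st}.
Proof. by move=> x xst; rewrite mem_cat xst orbT. Qed.

Lemma spec_replace (a c : k.-tuple g) down (post : bool + bool -> cfg g -> Prop) :
  post (inl down) (c, saved (PS b) c ++ st) ->
  spec true (replace b ;; mret _ _ _ (inl down)) (c, saved (PS b) a ++ st) post.
Proof.
move=> P; apply: spec_seq; apply: spec_seq; apply: spec_pop_saved.
apply: spec_dropall; [exact: PS_inj | | exact: spec_ret].
by move=> j; apply: (valid_fresh _ _ Vst); lia.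
Qed.

Lemma spec_finish (a w : k.-tuple g) r (post : bool + bool -> cfg g -> Prop) :
  post (inr r) (w, st) -> spec true (finish b r) (w, saved (PS b) a ++ st) post.
Proof. by move=> P; apply: spec_seq; apply: spec_pop_saved; exact: spec_ret. Qed.

Lemma spec_mfind_saved B (a w : k.-tuple g) (p : pred (k.-tuple g))
    (post : bool -> cfg g -> Prop) :
  (forall pe (c : k.-tuple g) st', valid (b.+1 + k) st' ->
     {subset saved (PS b) a ++ st <= st'} -> pos st' pe c -> computes (B pe) st' (p c)) ->
  (forall t : k.-tuple g, least key p t -> post true (t, saved (PS b) a ++ st)) ->
  (forall u', (forall t : k.-tuple g, ~~ p t) -> post false (u', saved (PS b) a ++ st)) ->
  spec true (mfind b.+1 po B) (w, saved (PS b) a ++ st) post.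
Proof.
move=> HB Pt Pf; apply: spec_mfind Pt Pf => //; first by lia.
- exact: valid_saved_st.
- exact: sub_saved.
Qed.

Lemma least_unique (p : pred (k.-tuple g)) x y : least key p x -> least key p y -> x = y.
Proof.
by move=> [px xmin] [py ymin]; apply: key_inj; apply/eqP; rewrite eqn_leq xmin ?ymin.
Qed.

(** Each constructor of [tour] is one round of the loop, so induction on [tour] gives termination
    together with the answer. The searches agree with [tour] because an element of least [key] is
    unique. *)
Lemma tour_correct down a r : tour R key u v down a r -> forall w,
  spec true (miter t0 (tour_body b po Rm pu pv) down) (w, saved (PS b) a ++ st)
    (fun r' c => c.2 = st /\ r' = r).
Proof.
have Usv (z : k.-tuple g) := valid_uniq (valid_saved_st z).
have sameP (z c w : k.-tuple g) pe R' (m1 m2 : mach R') post : pos st pe c ->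
    (forall w, spec true (if z == c then m1 else m2) (w, saved (PS b) z ++ st) post) ->
    spec true (mif t0 (same (px b) pe) m1 m2) (w, saved (PS b) z ++ st) post.
  move=> pc H; apply: spec_if.
  apply: spec_conseq (computes_same (Usv z) (pos_px z) (pos_sub (@sub_saved z) pc) w) _.
  by move=> r' [w1 st1] /= [-> ->].
have childP (z w : k.-tuple g) post :
    (forall t, least key ((child R v)^~ z) t -> post true (t, saved (PS b) z ++ st)) ->
    (forall u', (forall t, ~~ child R v t z) -> post false (u', saved (PS b) z ++ st)) ->
    spec true (mfind b.+1 po (fun pc => mand (Rm (b.+1 + k) pc (px b)) (mnot (same pc pv))))
      (w, saved (PS b) z ++ st) post.
  move=> Pt Pf; apply: spec_mfind_saved Pt Pf => pe c st' V' sub' pc.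
  have sub'' : {subset st <= st'} by move=> y yst; apply: sub'; exact: sub_saved.
  apply: computes_and; last first.
    by apply: computes_not; apply: computes_same (valid_uniq V') pc (pos_sub sub'' pvv).
  apply: Rm_computes => //; first by lia.
  exact: pos_sub sub' (pos_px z).
have parentP (z w : k.-tuple g) post :
    (forall t, least key (R z) t -> post true (t, saved (PS b) z ++ st)) ->
    (forall u', (forall t, ~~ R z t) -> post false (u', saved (PS b) z ++ st)) ->
    spec true (mfind b.+1 po (fun pp => Rm (b.+1 + k) (px b) pp))
      (w, saved (PS b) z ++ st) post.
  move=> Pt Pf; apply: spec_mfind_saved Pt Pf => pe c st' V' sub' pc.
  have sub'' : {subset st <= st'} by move=> y yst; apply: sub'; exact: sub_saved.
  apply: Rm_computes => //; first by lia.
  exact: pos_sub sub' (pos_px z).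
have nextP (z w : k.-tuple g) post :
    (forall t, least key (sibling R key v z) t -> post true (t, saved (PS b) z ++ st)) ->
    (forall u', (forall t, ~~ sibling R key v z t) -> post false (u', saved (PS b) z ++ st)) ->
    spec true (mfind b.+1 po (fun pc =>
           mand (mnot (same pc pv)) (mand (less (b.+1 + k) po (px b) pc)
             (msearch k (b.+1 + k) po [::] (fun pp =>
                mand (Rm (b.+1 + k + k) (px b) pp) (Rm (b.+1 + k + k) pc pp))))))
      (w, saved (PS b) z ++ st) post.
  move=> Pt Pf; apply: spec_mfind_saved Pt Pf => pe c st' V' sub' pc.
  have sub'' : {subset st <= st'} by move=> y yst; apply: sub'; exact: sub_saved.
  have pz : pos st' (px b) z := pos_sub sub' (pos_px z).
  apply: computes_and; first by apply: computes_not; apply: computes_same (valid_uniq V') pc (pos_sub sub'' pvv).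
  apply: computes_and; first by apply: computes_less => //; [lia | exact: sub''].
  pose p s := if insub s is Some t then R z t && R c t else false.
  have -> : [exists t, R z t && R c t] = has p (tups k).
    apply/existsP/hasP => [[t zct]|[s sk]].
      by exists (tval t); rewrite ?key_tups // /p valK.
    by rewrite /p; case: insubP => // t _ _; exists t.
  apply: computes_msearch => //; [lia | exact: sub'' | ].
  move=> pp s st2 V2 sub2 ps Es.
  have [t Et] : exists t : k.-tuple g, s = t by exists (Tuple (introT eqP Es)).
  rewrite {}Et in ps *; rewrite /p valK.
  have sub3 : {subset st <= st2} by move=> y /sub''/sub2.
  apply: computes_and; apply: Rm_computes => //; try lia; exact: pos_sub sub2 _.
elim=> {down a r} [|a c r nau lc _ IH|a r nau nc _ IH||a c r nav lc _ IH|a p r nav ns Rap _ IH] w;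
  apply: spec_iter_unfold; rewrite /tour_body.
- apply: sameP puu _ => w1; rewrite eqxx; exact: spec_finish.
- apply: sameP puu _ => w1; rewrite (negPf nau); apply: spec_if; apply: childP.
    move=> t lt; rewrite (least_unique lt lc); apply: spec_replace; exact: IH.
  by move=> u' /(_ c); case: lc => ->.
- apply: sameP puu _ => w1; rewrite (negPf nau); apply: spec_if; apply: childP.
    by move=> t [ct _]; have := nc t; rewrite ct.
  by move=> u' _; apply: spec_ret; exact: IH.
- apply: sameP pvv _ => w1; rewrite eqxx; exact: spec_finish.
- apply: sameP pvv _ => w1; rewrite (negPf nav); apply: spec_if; apply: nextP.
    move=> t lt; rewrite (least_unique lt lc); apply: spec_replace; exact: IH.
  by move=> u' /(_ c); case: lc => ->.
- apply: sameP pvv _ => w1; rewrite (negPf nav); apply: spec_if; apply: nextP.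
    by move=> t [ct _]; have := ns t; rewrite ct.
  move=> u' _; apply: spec_if; apply: parentP.
    by move=> t [at_ _]; rewrite (R_fun at_ Rap); apply: spec_replace; exact: IH.
  by move=> u2 /(_ p); rewrite Rap.
Qed.

Lemma computes_closure : computes (mclosure b po Rm pu pv) st (connect R u v).
Proof.
move=> w; apply: spec_seq; apply: spec_load pvv _; first exact: valid_uniq Vst.
apply: spec_seq; apply: spec_dropall => [|j|]; first exact: PS_inj.
  by apply: (valid_fresh _ _ Vst); lia.
exact: tour_correct (tour_connect u v R_fun key_inj) _.
Qed.

End Closure.

(** Levels needed by [eval]. A closure takes one for the current tuple, [k] for the tuple sought,
    and [k] more for the common image of siblings, below the levels for its body. *)
Fixpoint depth (phi : formula Sigma k) : nat :=
  match phi with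
  | Lab _ _ | Edg _ _ _ | Eq _ _ => 0
  | Not p => depth p
  | And p q | Or p q => maxn (depth p) (depth q)
  | Ex _ p | All _ p => (depth p).+1
  | TC _ _ p _ _ => (k + k + depth p).+1
  end.

(** [b] is the first free level, and [rho] gives the pebble at which the value of each variable
    lies; a quantified variable uses the pebble of the search that ranges over it. *)
Fixpoint eval (phi : formula Sigma k) (b : nat) (rho : nat -> X) : mach bool :=
  match phi with
  | Lab s x => mact (Jump _ i0 (rho x)) ;; mtest (LabAt _ i0 s)
  | Edg s x y => mact (Jump _ i0 (rho x)) ;;
      mif t0 (mtest (OutEdge _ i0 s))
        (mact (OutMove _ i0 s) ;; mtest (PebAt _ i0 (rho y))) (mret _ _ _ false)
  | Eq x y => mact (Jump _ i0 (rho x)) ;; mtest (PebAt _ i0 (rho y))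
  | Not p => mnot (eval p b rho)
  | And p q => mand (eval p b rho) (eval q b rho)
  | Or p q => mor (eval p b rho) (eval q b rho)
  | Ex x p => msearch 1 b po [::] (fun pe => eval p b.+1 (bind rho [:: x] pe))
  | All x p => mnot (msearch 1 b po [::] (fun pe => mnot (eval p b.+1 (bind rho [:: x] pe))))
  | TC xs ys p us vs =>
      mclosure b po (fun c pa pb => eval p c (bind rho (xs ++ ys) (pa ++ pb)))
        (map rho us) (map rho vs)
  end.

Lemma pos_map (st : seq (X * g)) (rho : nat -> X) (e : nat -> g) (us : seq nat) :
  (forall z, (rho z, e z) \in st) -> pos st (map rho us) (map e us).
Proof.
move=> re; rewrite /pos !size_map eqxx /=.
by elim: us => //= z us IH; rewrite re.
Qed.

Lemma peb_eq (st : seq (X * g)) x v w : uniq (names st) -> (x, v) \in st ->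
  ((x, w) \in st) = (w == v).
Proof.
move=> Ust xv; apply/idP/eqP => [xw|-> //]; exact: uniq_names_inj Ust xw xv.
Qed.

Lemma has_tups1 (p : pred (seq g)) : has p (tups 1) = [exists v : g, p [:: v]].
Proof.
apply/hasP/existsP => [[s /allpairsP[[v t] /= [_ /[!inE]/eqP-> ->]] pv]|[v pv]].
  by exists v.
by exists [:: v] => //; apply: (mem_tups [:: v]).
Qed.

Lemma computes_eval phi b rho (e : nat -> g) st : FO_DTC phi ->
  b + depth phi <= D -> valid b st -> (po, o) \in st ->
  (forall z, (rho z, e z) \in st) -> computes (eval phi b rho) st (holds e phi).
Proof.
elim: phi b rho e st => [s x|s x y|x y|p IH|p IHp q IHq|p IHp q IHq|x p IH|x p IH|xs ys p IH us vs]
  b rho e st /= Fp bD Vst poo re.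
- move=> u; apply: spec_seq; apply: spec_jump (re x) _; first exact: valid_uniq Vst.
  by apply: spec_test; rewrite /= tnth_move_head eqxx.
- have Ust := valid_uniq Vst.
  move=> u; apply: spec_seq; apply: spec_jump (re x) _ => //.
  apply: spec_if; apply: spec_test; rewrite /= tnth_move_head eqxx.
  have [/existsP[v xv]|/existsPn none] := boolP [exists v, edg s (e x) v].
    apply: spec_seq; apply: (@spec_outmove _ _ _ _ _ _ _ v); first by rewrite tnth_move_head eqxx.
    apply: spec_test; rewrite /= tnth_move_head eqxx (peb_eq _ Ust (re y)); split=> //.
    by apply/eqP/idP => [<- //|xy]; exact: edg_out_unique xv xy.
  by apply: spec_ret; split=> //; rewrite (negPf (none _)).
- have Ust := valid_uniq Vst.
  move=> u; apply: spec_seq; apply: spec_jump (re x) _ => //.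
  by apply: spec_test; rewrite /= tnth_move_head eqxx (peb_eq _ Ust (re y)).
- by apply: computes_not; exact: IH.
- by case: Fp => Fp Fq; apply: computes_and; [apply: IHp | apply: IHq] => //; lia.
- by case: Fp => Fp Fq; apply: computes_or; [apply: IHp | apply: IHq] => //; lia.
- pose h c := holds (bind e [:: x] c) p; rewrite -(has_tups1 h).
  apply: (@computes_msearch 1 b (fun pe => eval p b.+1 (bind rho [:: x] pe))) => //.
    by lia.
  move=> pe c st' V' sub pc Es; apply: IH => //; [lia | by rewrite -addn1 | exact: sub |].
  by move=> z; apply: (pos_bind (xs := [:: x]) z pc Es) => y; exact: sub.
- pose h c := ~~ holds (bind e [:: x] c) p.
  have -> : [forall v, holds (bind e [:: x] [:: v]) p] = ~~ has h (tups 1).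
    by rewrite has_tups1 negb_exists; apply: eq_forallb => v; rewrite negbK.
  apply: computes_not.
  apply: (@computes_msearch 1 b (fun pe => mnot (eval p b.+1 (bind rho [:: x] pe)))) => //.
    by lia.
  move=> pe c st' V' sub pc Es; apply: computes_not.
  apply: IH => //; [lia | by rewrite -addn1 | exact: sub |].
  by move=> z; apply: (pos_bind (xs := [:: x]) z pc Es) => y; exact: sub.
- case: Fp => _ p_fun Fp; apply: (@computes_closure b (depth p)) => //; first by lia.
  + exact: pos_map.
  + exact: pos_map.
  + by move=> a c c'; exact: p_fun.
  move=> c st' pe qe a a' cD V' sub pa qa'; apply: IH => //; first exact: sub.
  move=> z; apply: pos_bind => [||y]; [exact: pos_cat | by rewrite !size_cat !size_tuple | ].
  exact: sub.
Qed.

End Total.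

(** * Testing whether the guide searches the graph *)

Definition visited g (o w : g) := exists l c, trace o l c /\ w \in l ++ heads c.

Lemma visited_rest g (o w : g) vl : visited o w -> rest (start G o) vl -> w \in vl.
Proof.
move=> [l [c [tr wl]]] r; have [s /rest_heads[s' ->] ->] := rest_trace tr r.
by rewrite catA mem_cat wl.
Qed.

Definition adj g (d : Sigma * bool) (w w' : g) :=
  if d.2 then edg d.1 w w' else edg d.1 w' w.

(** The [d]-neighbour of the node at [xw] is marked with a pebble, and the guide is run from [xv] to
    see whether it ever meets the mark. *)
Definition bad_edge b xv xw (d : Sigma * bool) : mach bool :=
  mact (Jump _ i0 xw) ;;
  mif t0 (mtest (if d.2 then OutEdge _ i0 d.1 else InEdge _ i0 d.1))
    (mact (if d.2 then OutMove _ i0 d.1 else InMove _ i0 d.1) ;;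
     mact (Drop _ i0 (PS b i0)) ;;
     mbind t0 (search b.+1 xv (fun xz => mact (Jump _ i0 xz) ;; mtest (PebAt _ i0 (PS b i0))))
       (fun r => mact (Retrieve _ _ (PS b i0)) ;; mret _ _ _ (~~ r)))
    (mret _ _ _ false).

Definition bad_node b xv xw : mach bool :=
  foldr (fun d => mor (bad_edge b xv xw d)) (mret _ _ _ false) (enum {: Sigma * bool}).

Definition check_from b xv : mach bool := mnot (search b xv (bad_node b.+1 xv)).

(* The automaton must be start-independent on all graphs, including those that the
   guide fails to search.  It therefore first checks that the guide, started at any
   node, halts and visits a set closed under adjacency; it loops or rejects if not. *)
Definition check b po : mach bool :=
  mnot (search b po (fun xv => mnot (check_from b.+1 xv))).

(** The answers are asymmetric: that a node is missed is known only after the guide has halted, that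
    it is visited already when it is met. Hence [rest] in one case and the weaker [visited] in the
    other. *)
Lemma spec_bad_edge (tot : bool) b g (v w : g) xv xw d (u : k.-tuple g) st :
  b.+1 <= D -> valid b st -> (xv, v) \in st -> (xw, w) \in st ->
  (tot -> exists vl, rest (start G v) vl) ->
  spec tot (bad_edge b xv xw d) (u, st) (fun r c => c.2 = st /\
    if r then exists w' vl, [/\ adj d w w', rest (start G v) vl & w' \notin vl]
    else forall w', adj d w w' -> visited v w').
Proof.
move=> bD Vst xvv xww halts; have Ust := valid_uniq Vst.
apply: spec_seq; apply: spec_jump xww _ => //.
apply: spec_if; apply: spec_test.
have -> : eval_test (if d.2 then OutEdge X i0 d.1 else InEdge X i0 d.1)
    (move_head u i0 w) st = [exists w', adj d w w'].
  by rewrite /adj; case: d.2; rewrite /= tnth_move_head eqxx.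
have [/existsP[w' ww']|/existsPn none] := boolP [exists w', adj d w w']; last first.
  by apply: spec_ret; split=> // w' ww'; have := none w'; rewrite ww'.
have adj_fun x : adj d w x -> x = w'.
  move: ww'; rewrite /adj; case: d.2 => a1 a2; first exact: edg_out_unique a2 a1.
  exact: edg_in_unique a2 a1.
have moveP (c : k.-tuple g) (post : unit -> cfg g -> Prop) : tnth c i0 = w ->
    post tt (move_head c i0 w', st) ->
    spec tot (mact (if d.2 then OutMove X i0 d.1 else InMove X i0 d.1)) (c, st) post.
  move=> cw P; move: ww'; rewrite /adj; case: d.2 => a1.
    by apply: spec_outmove P; rewrite cw.
  by apply: spec_inmove P; rewrite cw.
apply: spec_seq; apply: moveP; first by rewrite tnth_move_head eqxx.
apply: spec_seq; apply: spec_drop; first by apply: (valid_fresh _ _ Vst); lia.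
rewrite tnth_move_head eqxx.
have V1 : valid b.+1 ((PS b i0, w') :: st).
  have /andP[_ lev] := valid_leq (leqnSn b) Vst.
  rewrite /valid /= Ust lev !andbT inordK ?ltnSn ?andbT; last by lia.
  by apply: (valid_fresh _ _ Vst); lia.
apply: spec_bind.
apply: (@spec_search tot b.+1 xv _ g v _ _ (fun x _ => x = w') (fun x => x <> w')) => //.
- by rewrite inE xvv orbT.
- move=> x z u' st' V' sub xz; have U' := valid_uniq V'.
  apply: spec_seq; apply: spec_jump xz _ => //; apply: spec_test; split=> //=.
  rewrite tnth_move_head eqxx (peb_eq _ U' (v := w')); last by apply: sub; rewrite mem_head.
  by case: eqP.
- move=> l c pre z suf u' tr El _ Ez; apply: spec_seq; apply: spec_retrieve.
  apply: spec_ret; split=> // x /adj_fun->; exists l, c; split=> //.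
  by rewrite El -Ez mem_cat mem_head orbT.
- move=> vl u' r nw; apply: spec_seq; apply: spec_retrieve.
  apply: spec_ret; split=> //; exists w', vl; split=> //.
  by apply/negP => /nw.
Qed.

Lemma spec_bad_node (tot : bool) b g (v w : g) xv xw (u : k.-tuple g) st :
  b.+1 <= D -> valid b st -> (xv, v) \in st -> (xw, w) \in st ->
  (tot -> exists vl, rest (start G v) vl) ->
  spec tot (bad_node b xv xw) (u, st) (fun r c => c.2 = st /\
    if r then exists d w' vl, [/\ adj d w w', rest (start G v) vl & w' \notin vl]
    else forall d w', adj d w w' -> visited v w').
Proof.
move=> bD Vst xvv xww halts; rewrite /bad_node.
suff gen l : spec tot (foldr (fun d => mor (bad_edge b xv xw d)) (mret _ _ _ false) l)
    (u, st) (fun r c => c.2 = st /\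
    if r then exists d w' vl, [/\ adj d w w', rest (start G v) vl & w' \notin vl]
    else forall d w', d \in l -> adj d w w' -> visited v w').
  apply: spec_conseq (gen _) _ => -[] c [-> H]; split=> // d w'; apply: H.
  by rewrite mem_enum.
elim: l u => [|d l IH] u; first by apply: spec_ret; split.
apply: spec_if; apply: spec_conseq (spec_bad_edge d u bD Vst xvv xww halts) _.
move=> [] [u' st'] /= [-> H]; first by apply: spec_ret; split=> //; exists d.
apply: spec_conseq (IH u') _ => -[] c [-> H']; split=> // d' w'.
by rewrite inE => /predU1P[->|]; [exact: H | exact: H'].
Qed.

Lemma rest_start g (v : g) vl : rest (start G v) vl -> v \in vl.
Proof.
case/rest_heads=> s ->; rewrite mem_cat; apply/orP; left.
by apply/tnthP; exists i0; rewrite tnth_mktuple.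
Qed.

(** By weak connectivity a nonempty set of nodes closed under adjacency in both directions is
    everything. *)
Lemma closed_goodfrom g (v : g) vl : rest (start G v) vl ->
  (forall w d w', w \in vl -> adj d w w' -> w' \in vl) -> goodfrom v.
Proof.
move=> r closed; exists vl => // x.
have vvl := rest_start r.
have /connectP[p + ->] := weakly_connected v x.
elim: p v vvl {r} => //= w p IH v vvl /andP[/existsP[s vw]]; apply: IH.
case/orP: vw => vw; first exact: (closed v (s, true)).
exact: (closed v (s, false)).
Qed.

Lemma spec_check_from (tot : bool) b g (v : g) xv (u : k.-tuple g) st :
  b.+2 <= D -> valid b st -> (xv, v) \in st -> (tot -> goodfrom v) ->
  spec tot (check_from b xv) (u, st) (fun r c => c.2 = st /\
    if r then goodfrom v else ~ goodfrom v).
Proof.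
move=> bD Vst xvv halts.
have halts' : tot -> exists vl, rest (start G v) vl.
  by move=> /halts[vl r _]; exists vl.
apply: spec_mmap; apply: (@spec_search tot b xv _ g v _ _
  (fun w _ => exists d w' vl, [/\ adj d w w', rest (start G v) vl & w' \notin vl])
  (fun w => forall d w', adj d w w' -> visited v w')) => //; first by lia.
- move=> x w u' st' V' sub xw; apply: spec_bad_node => //; exact: sub.
- move=> l c pre z suf u' _ _ _ [d [w' [vl [_ r nw']]]]; split=> // -[vl' r' all'].
  by move: nw'; rewrite (rest_fun r r') all'.
- move=> vl u' r H; split=> //; apply: (closed_goodfrom r) => w d w' /H wP /wP.
  by move=> /visited_rest; apply.
Qed.

(** Only the nodes that the guide visits from [o] are checked. This suffices: [o] is among them, and
    a positive check at [o] says that all nodes are visited from there. *)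
Lemma spec_check (tot : bool) b g (o : g) po (u : k.-tuple g) st :
  b.+3 <= D -> valid b st -> (po, o) \in st -> (tot -> good g) ->
  spec tot (check b po) (u, st) (fun r c => c.2 = st /\
    if r then good g else ~ good g).
Proof.
move=> bD Vst poo halts.
apply: spec_mmap; apply: (@spec_search tot b po _ g o _ _
  (fun v _ => ~ goodfrom v) (@goodfrom g)) => //; first by lia.
- by move=> /halts/(_ o)[vl r _]; exists vl.
- move=> x v u' st' V' sub xv; apply: spec_mmap.
  apply: spec_conseq (spec_check_from u' _ V' xv _) _; [lia | by move=> t; exact: halts |].
  by case.
- by move=> l c pre v suf u' _ _ _ nv; split=> // /(_ v).
- move=> vl u' r H; split=> // v.
  have [vl' r' all'] := H _ (rest_start r).
  by apply: H; rewrite (rest_fun r r').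
Qed.

Lemma guides_good g : guides G g -> good g.
Proof.
move=> gg o; have [n [w [w0 walk_n hn visits]]] := gg o.
suff [s r sub] : exists2 s, rest (w 0) s & forall m, m <= n -> {subset heads (w m) <= s}.
  by exists s; [rewrite -w0 | move=> v; have [m mn vm] := visits v; exact: sub mn v vm].
elim: n w walk_n hn {w0 visits} => [|n IH] w wn hn.
  by exists (heads (w 0)); [exact: rest_halt | move=> [|//] _ x].
have [|//|s r sub] := IH (fun i => w i.+1); first by move=> i lti; exact: wn.
exists (heads (w 0) ++ s); first exact: rest_step (wn 0 isT) r.
by move=> [|m] mn x xm; rewrite mem_cat ?xm // (sub m) ?orbT.
Qed.

Definition program phi : mach bool :=
  let po := PS 0 i0 in
  mact (Drop _ i0 po) ;;
  mbind t0 (mif t0 (check 1 po) (eval po phi 1 (fun _ => po)) (mret _ _ _ false))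
    (fun r => mact (Retrieve _ _ po) ;; mret _ _ _ r).

Lemma spec_program (tot : bool) phi g (u : g) : FO_DTC phi -> (depth phi).+4 <= D ->
  (tot -> good g) ->
  spec tot (program phi) ([tuple u | _ < k], [::]) (fun r c => c.2 = [::] /\
    (r <-> good g /\ holds (fun _ => u) phi)).
Proof.
move=> Fp dD halts; apply: spec_seq; apply: spec_drop => //.
rewrite tnth_mktuple; set st := [:: _].
have Vst : valid 1 st by rewrite /valid /= inordK.
have pou : (PS 0 i0, u) \in st by rewrite mem_head.
apply: spec_bind; apply: spec_if.
apply: spec_conseq (spec_check _ _ Vst pou halts) _; first by lia.
move=> [] [u' st'] /= [-> gP]; last first.
  apply: spec_ret; apply: spec_seq; apply: spec_retrieve; apply: spec_ret.
  by split=> //; split=> [//|[]].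
(* A positive check puts the evaluation in the setting of total correctness, whatever [tot] is. *)
have [vl r all_vl] := gP u; apply: spec_total.
apply: spec_conseq (computes_eval (e := fun _ => u) r all_vl Fp _ Vst pou (fun _ => pou) u') _.
  by lia.
move=> r' [u2 st2] /= [-> ->]; apply: spec_seq; apply: spec_retrieve.
by apply: spec_ret; split=> //; split=> [|[]].
Qed.

(** Valid on every graph: from left to right partial correctness suffices, and from right to left
    [good g] provides termination. As [good g] does not mention [u], start-independence follows for
    closed formulas. *)
Lemma program_acc phi g (u : g) : FO_DTC phi -> (depth phi).+4 <= D ->
  acc (machine_automaton (program phi)) u <-> good g /\ holds (fun _ => u) phi.
Proof.
move=> Fp dD; split=> [/acc_machine[v H]|gu].
  have nt : false -> good g by [].
  by have [_ P] := spec_program u Fp dD nt; have [_ <-] := P _ _ H.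
have [T P] := spec_program u Fp dD (fun _ : true => gu.1).
have [r [[v st] H]] := T isT; have [/= Est rP] := P _ _ H.
by apply: (@machine_acc _ _ _ _ _ _ v); move: H; rewrite Est; have -> : r = true by exact/rP.
Qed.

End Search.

Lemma formula_automaton (Sigma : finType) (k : nat) (F : graph Sigma -> Prop)
    (phi : formula Sigma k) : 0 < k -> searchable k F -> FO_DTC phi ->
  closed_formula phi -> exists A : automaton Sigma k,
    [/\ deterministic A, start_independent A
      & forall g, F g -> (language A g <-> models g phi)].
Proof.
move=> k_gt0 [G [dG jG gG]] Fp cp.
(* The start node is marked at level 0; [check] begins at level 1 and nests three further levels, up
   to 4, while evaluation needs [1 + depth phi]. Adding 4 to the depth covers both. *)
pose m := program (Ordinal k_gt0) G (depth phi).+4 phi.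
have accE (g : graph Sigma) (u : g) := @program_acc _ _ (Ordinal k_gt0) G _ dG jG phi g u Fp (leqnn _).
have indep (g : graph Sigma) (e e' : nat -> g) : holds e phi = holds e' phi.
  by apply: holds_fv => z; rewrite cp.
exists (machine_automaton m); split; first exact: machine_automaton_det.
  by move=> g u1 u2 /accE[gg u1P]; apply/accE; split=> //; rewrite (indep g _ (fun=> u1)).
move=> g /gG/guides_good gg; split=> [L e|M u]; last by apply/accE.
have /card_gt0P[u _] : 0 < #|g| by exact: node_nonempty.
by have /accE[_] := L u; rewrite (indep g _ e).
Qed.

Theorem theorem7p4 (Sigma : finType) (k : nat) (F : graph Sigma -> Prop)
    (hk : 1 <= k) (hF : searchable k F) :
  (forall A : automaton Sigma k, deterministic A -> start_independent A ->
     exists phi : formula Sigma k,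
       [/\ FO_DTC phi, closed_formula phi
         & forall g, F g -> (language A g <-> models g phi)])
  /\
  (forall phi : formula Sigma k, FO_DTC phi -> closed_formula phi ->
     exists A : automaton Sigma k,
       [/\ deterministic A, start_independent A
         & forall g, F g -> (language A g <-> models g phi)]).
Proof.
split=> [A dA _|phi Fp cp]; last exact: formula_automaton.
have [phi [Fp cp H]] := automaton_formula dA hk.
by exists phi; split=> // g _; exact: H.
Qed.
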